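(* Let $F\in\mathrm{dom}(D)$ with $\mathbb{E}[F]=0$ and let $N$ be a standard Gaussian random variable. Then \begin{align*} d_K(F,N)&\leq\mathbb{E}\big[|1-\langle DF,-DL^{-1}F\rangle_{\ell^2(\mathbb{N})}|\big]+\frac{\sqrt{2\pi}}{4}\,\mathbb{E}\big[\langle(DF)^2,|DL^{-1}F|\rangle_{\ell^2(\mathbb{N})}\big]\\ &\quad+\mathbb{E}\big[\langle(DF)^2,|F\cdot DL^{-1}F|\rangle_{\ell^2(\mathbb{N})}\big]+2\,\sup_{x\in\mathbb{R}}\mathbb{E}\big[\langle (DF)\,D\mathbf{1}_{\{F>x\}},|DL^{-1}F|\rangle_{\ell^2(\mathbb{N})}\big]. \end{align*}
   Context: Rademacher sequence: $\Omega=\{-1,+1\}^{\mathbb{N}}$, $\mathbb{N}=\{1,2,\dots\}$, with the product $\sigma$-field and $P=(\frac12\delta_{-1}+\frac12\delta_{+1})^{\otimes\mathbb{N}}$; $X_n(\omega)=\omega_n$, so $X=(X_n)_{n\in\mathbb{N}}$ is i.i.d. uniform on $\{\pm1\}$. $L^2(\Omega)$ is the space of square-integrable random variables on this space. Kernels: $\Delta_n=\{(i_1,\dots,i_n)\in\mathbb{N}^n: i_k\ne i_l\text{ for }k\neq l\}$; $\ell_0^2(\mathbb{N})^{\circ n}$ is the set of symmetric square-summable functions on $\mathbb{N}^n$ vanishing outside $\Delta_n$ (and $\mathbb{R}$ for $n=0$). Discrete multiple stochastic integrals: for $f\in\ell_0^2(\mathbb{N})^{\circ q}$, $q\ge1$,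 $J_q(f)=q!\sum_{1\le i_1<\dots<i_q<\infty}f(i_1,\dots,i_q)X_{i_1}\cdots X_{i_q}$, and $J_0(c)=c$. Every $F\in L^2(\Omega)$ has a unique chaotic decomposition $F=\mathbb{E}[F]+\sum_{n\ge1}J_n(f_n)$ with $f_n\in\ell_0^2(\mathbb{N})^{\circ n}$. Malliavin operators: $F\in\mathrm{dom}(D)$ iff $\sum_{n\geq1}n\,n!\|f_n\|^2_{\ell^2(\mathbb{N})^{\otimes n}}<\infty$, and then $DF=(D_kF)_{k\in\mathbb{N}}$ with $D_kF=\sum_{n\ge1}nJ_{n-1}(f_n(\cdot,k))$; pathwise $D_kF=\frac12(F_k^+-F_k^-)$, where $F_k^\pm(\omega)=F(\omega_1,\dots,\omega_{k-1},\pm1,\omega_{k+1},\dots)$. For functionals not in $\mathrm{dom}(D)$, $D_kF$ is understood as $\frac12(F_k^+-F_k^-)$; in particular $D_k\mathbf{1}_{\{F>x\}}=\frac12(\mathbf{1}_{\{F_k^+>x\}}-\mathbf{1}_{\{F_k^->x\}})$. For centred $F=\sum_{n\ge1}J_n(f_n)\in L^2(\Omega)$, $L^{-1}F=-\sum_{n\ge1}\frac1nJ_n(f_n)$. Products, powers and absolute values of sequences are taken componentwise, e.g. $(DF)^2=((D_kF)^2)_k$, and $\langle u,v\rangle_{\ell^2(\mathbb{N})}=\sum_ku_kv_k$. The Kolmogorov distance is $d_K(F,N)=\sup_{x\in\mathbb{R}}|P(F\le x)-P(N\le x)|$. *)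

(* Defs.v *)
From HB Require Import structures.
From mathcomp Require Import all_boot all_order all_algebra.
From mathcomp Require Import all_classical all_reals all_analysis.
Import Order.TTheory GRing.Theory Num.Theory.
Import numFieldNormedType.Exports.

Set Implicit Arguments.
Unset Strict Implicit.
Unset Printing Implicit Defensive.

Local Open Scope classical_set_scope.
Local Open Scope ring_scope.

(* Conventions: the index set {1, 2, ...} is relabelled as nat = {0, 1, ...},
   and a point of {-1, +1}^N is encoded as a boolean sequence, true standing
   for +1 and false for -1; [rad] decodes it. *)

(* Coordinate events; they generate the product sigma-algebra. *)
Definition coord_events : set (set (nat -> bool)) :=
  [set A | exists k b, A = [set w | w k = b]].

Definition Omega := g_sigma_algebraType coord_events.

Section rademacher.
Context {R : realType}.

(* P is the infinite product of copies of (delta_{-1} + delta_{+1}) / 2: this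
   product rule determines P, since finite-dimensional rectangles form a
   pi-system generating the sigma-algebra of Omega. *)
Definition is_rademacher_measure (P : probability Omega R) : Prop :=
  forall (n : nat) (A : nat -> set bool),
    P [set w : Omega | forall i, (i < n)%N -> A i (w i)] =
    (\prod_(i < n) bernoulli_prob (2^-1 : R) (A i))%E.

Definition rad (k : nat) (w : Omega) : R := if w k then 1 else - 1.

Definition set_coord (k : nat) (b : bool) (w : Omega) : Omega :=
  fun i => if i == k then b else w i.

Definition path_gradient (F : Omega -> R) (k : nat) (w : Omega) : R :=
  (F (set_coord k true w) - F (set_coord k false w)) / 2.

Definition sq_norm n (f : n.-tuple nat -> R) : \bar R :=
  (\esum_(t in [set: n.-tuple nat]) ((f t) ^+ 2)%:E)%E.

(* For n = 0 the only tuple is the empty one, so such an f is just a real. *)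
Definition is_kernel n (f : n.-tuple nat -> R) : Prop :=
  [/\ forall s t : n.-tuple nat, perm_eq s t -> f s = f t,
      forall t : n.-tuple nat, ~~ uniq t -> f t = 0
    & (sq_norm f < +oo)%E].

(* The function f(., k) of n variables, for f of n + 1 variables. *)
Definition slice n (f : n.+1.-tuple nat -> R) (k : nat) : n.-tuple nat -> R :=
  fun t => f (rcons_tuple t k).

(* Partial sum over i_1 < ... < i_q < m of the series defining J_q(f). *)
Definition J_upto q (f : q.-tuple nat -> R) (m : nat) (w : Omega) : R :=
  q`!%:R * \sum_(t : q.-tuple 'I_m | sorted ltn (map val t))
             f (map_tuple val t) * \prod_(i <- t) rad (val i) w.

Section operators.
Variable P : probability Omega R.

Definition L2_cvg (u : nat -> Omega -> R) (Y : Omega -> R) : Prop :=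
  [/\ forall n, u n \in Lfun P 2%:E, Y \in Lfun P 2%:E
    & 'N[P]_2%:E[EFin \o (u n \- Y)%R]%E @[n --> \oo] --> 0%E].

(* A version of the limit in L^2, and 0 when there is none. The operators
   below are thus defined up to almost sure equality only. *)
Definition L2_lim (u : nat -> Omega -> R) : Omega -> R :=
  xget (cst 0) [set Y | L2_cvg u Y].

Definition J q (f : q.-tuple nat -> R) : Omega -> R := L2_lim (J_upto f).

Definition kernels := forall n, n.-tuple nat -> R.

(* F = E[F] + sum_{n >= 1} J_n(f_n) in L^2; the entry f_0 is not used. *)
Definition chaos_decomposition (F : Omega -> R) (f : kernels) : Prop :=
  [/\ F \in Lfun P 2%:E,
      forall n, is_kernel (f n)
    & L2_cvg (fun m w => fine 'E_P[F] + \sum_(1 <= n < m.+1) J (f n) w) F].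

(* The decomposition is unique, except for the unused f_0. *)
Definition chaos_kernels (F : Omega -> R) : kernels :=
  xget (fun _ _ => 0) [set f | chaos_decomposition F f].
Arguments chaos_kernels F n _ : clear implicits.

Definition dom_D (F : Omega -> R) : Prop :=
  exists2 f : kernels, chaos_decomposition F f &
    (\sum_(1 <= n <oo) ((n * n`!)%:R%:E * sq_norm (f n)) < +oo)%E.

(* D_k F = sum_{n >= 1} n J_{n-1}(f_n(., k)), summed over n - 1. *)
Definition D (F : Omega -> R) (k : nat) : Omega -> R :=
  L2_lim (fun m w =>
    \sum_(n < m) n.+1%:R * J (slice (chaos_kernels F n.+1) k) w).

Definition Linv (F : Omega -> R) : Omega -> R :=
  L2_lim (fun m w =>
    - \sum_(1 <= n < m.+1) n%:R^-1 * J (chaos_kernels F n) w).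

End operators.

(* Extended-real valued, so that sums of nonnegative terms always make sense. *)
Definition l2_inner (u v : nat -> R) : \bar R :=
  (\sum_(0 <= k <oo) (u k * v k)%:E)%E.

Definition kolmogorov_distance d1 d2 (T1 : measurableType d1)
    (T2 : measurableType d2) (P1 : probability T1 R) (P2 : probability T2 R)
    (F : T1 -> R) (G : T2 -> R) : \bar R :=
  ereal_sup [set `|P1 [set w | (F w <= x)%R] - P2 [set w | (G w <= x)%R]|%E
            | x in [set: R]].

Definition is_standard_gaussian d (T : measurableType d)
    (P : probability T R) (N : {RV P >-> R}) : Prop :=
  forall A : set R, measurable A ->
    distribution P N A = normal_prob (0 : R) 1 A.

End rademacher.

(* Main.v *)
(* Stein's method. For the bounded solution g of g'(z) - z g(z) = 1_{z <= x} - Phi(x),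
   P(F <= x) - Phi(x) = E[g'(F) - F g(F)]. Writing F = delta(-D L^{-1} F), the
   coordinatewise integration by parts turns E[F g(F)] into
   sum_k E[-D_k L^{-1} F * D_k g(F)], and a first-order Taylor expansion of g
   replaces D_k g(F) by g'(F) D_k F, up to a remainder controlled by (D_k F)^2 and
   by the jump of g' at x; since |g'| <= 1, the four terms of the bound appear.
   The series are handled through Walsh functions: D_k, L^{-1} and delta act on
   Walsh coefficients, so that each identity is checked on finite Walsh sums and
   passed to the limit in mean square; the operators defined by L^2 limits are
   then almost surely equal to the pathwise ones. *)
Require Import Defs.
From mathcomp Require Import all_boot all_order all_algebra.
From mathcomp Require Import all_classical all_reals all_analysis.
From mathcomp Require Import measurable_realfun ring lra.
Import Order.TTheory GRing.Theory Num.Theory.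
Import numFieldNormedType.Exports.

Set Implicit Arguments.
Unset Strict Implicit.
Unset Printing Implicit Defensive.

Local Open Scope classical_set_scope.
Local Open Scope ring_scope.

(* MathComp has another [rad]. *)
Local Notation rad := Defs.rad.

(** * The Gaussian Stein equation *)

(** The product F g(F) is not integrated by parts directly: the divergence of -D L^{-1} F is first
    truncated to K coordinates. The truncation converges to F in mean square, g is bounded, and for
    fixed K the integration by parts is a finite sum. This leaves two errors that vanish as K grows;
    the one in the pairing of D F with -D L^{-1} F vanishes in L^1 because both gradients have
    finite energy, for F by [dom_D] and for L^{-1} F because n (1/n)^2 <= 1. The constants come from
    comparing F at a point and at its flip, which differ by 2 |D_k F|. The solution is bounded by
    sqrt(2 pi) / 4, and z g(z) has Lipschitz constant |F| + sqrt(2 pi) / 4 around F, which gives the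
    second and third terms. A jump of g' across x costs half of 2 |D_k F|, which is 2 D_k F D_k 1_{F
    > x}. *)

Lemma mvt_everywhere (R : realType) (g dg : R -> R) (u v : R) : u < v ->
  (forall t : R, is_derive t 1 g (dg t)) ->
  exists2 c, u < c < v & g v - g u = dg c * (v - u).
Proof.
move=> uv dgE.
have cg : {within `[u, v], continuous g}.
  by apply: derivable_within_continuous => t _; have [] := dgE t.
have [c + gE] := MVT uv (fun t _ => dgE t) cg.
by rewrite in_itv/= => ?; exists c.
Qed.

(** Both B - g and B + g have a nonnegative derivative on the open interval, so neither decreases
    from u to v. Taking for B a primitive of the bound on g' replaces an integration of g'. *)
Lemma ler_dist_derive (R : realType) (g dg B dB : R -> R) (u v : R) : u <= v ->
  (forall t : R, is_derive t 1 g (dg t)) -> (forall t : R, is_derive t 1 B (dB t)) ->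
  (forall t : R, u < t < v -> `|dg t| <= dB t) ->
  `|g v - g u| <= B v - B u.
Proof.
rewrite le_eqVlt => /predU1P[->|uv] gE BE dgB; first by rewrite !subrr normr0.
have [c cuv cE] : exists2 c, u < c < v &
    (B \- g) v - (B \- g) u = (dB c - dg c) * (v - u).
  apply: (@mvt_everywhere R (B \- g) (fun t => dB t - dg t)) => //.
have [d duv dE] : exists2 c, u < c < v &
    (B \+ g) v - (B \+ g) u = (dB c + dg c) * (v - u).
  apply: (@mvt_everywhere R (B \+ g) (fun t => dB t + dg t)) => //.
have h1 : 0 <= (dB c - dg c) * (v - u).
  rewrite mulr_ge0// subr_ge0 ?(ltW uv)//.
  by rewrite (le_trans (ler_norm _))// dgB.
have h2 : 0 <= (dB d + dg d) * (v - u).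
  rewrite mulr_ge0// ?subr_ge0 ?(ltW uv)//.
  by have := dgB _ duv; rewrite ler_norml => /andP[] *; lra.
rewrite ler_norml; move: cE dE => /=; lra.
Qed.

(** * Gaussian density, distribution function and tail bounds *)

Section gaussian_density.
Context {R : realType}.
Implicit Types x z : R.

Definition gauss_const : R := Num.sqrt (2 * pi).
Definition gauss_density z : R := gauss_const^-1 * expR (- (z ^+ 2 / 2)).

Lemma gauss_const_gt0 : 0 < gauss_const.
Proof. by rewrite sqrtr_gt0 mulr_gt0// pi_gt0. Qed.

Lemma gauss_density_gt0 z : 0 < gauss_density z.
Proof. by rewrite mulr_gt0 ?expR_gt0// invr_gt0 gauss_const_gt0. Qed.

Lemma is_derive_expR_sqr z (k : R) :
  is_derive z 1 (fun y : R => expR (k * (y ^+ 2 / 2))) (k * z * expR (k * (z ^+ 2 / 2))).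
Proof.
pose g := fun y : R => k * (y ^+ 2 / 2).
have h : is_derive z 1 g (k * z).
  apply: is_derive_eq; rewrite ?scaler0 /GRing.scale /=.
  by field.
have := is_derive1_comp (is_derive_expR (g z)) h.
by rewrite /g /GRing.scale /= mulrC.
Qed.

Lemma is_derive_gauss_density z :
  is_derive z 1 gauss_density (- z * gauss_density z).
Proof.
have h := is_derive_expR_sqr z (-1).
rewrite (_ : gauss_density = gauss_const^-1 \*: (fun y : R => expR (-1 * (y ^+ 2 / 2)))); last first.
  by apply/funext => y; rewrite /gauss_density /= mulN1r.
apply: is_derive_eq.
by rewrite /= /GRing.scale /= !mulN1r; ring.
Qed.

Definition normal_cdf z : R := fine (normal_prob (0 : R) 1 `]-oo, z]%classic).

Lemma gauss_densityE z : normal_pdf (0 : R) 1 z = gauss_density z.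
Proof.
rewrite normal_pdfE//= /gauss_density /normal_peak /normal_fun; congr (_^-1 * _).
  by rewrite expr1n mul1r /gauss_const mulr_natl.
by rewrite subr0 expr1n mulNr.
Qed.

Lemma normal_cdf_ge0 z : 0 <= normal_cdf z.
Proof. by rewrite fine_ge0. Qed.

Lemma normal_cdf_le1 z : normal_cdf z <= 1.
Proof. by rewrite -lee_fin fineK ?fin_num_measure// probability_le1. Qed.

Lemma is_derive_normal_cdf z : is_derive z 1 normal_cdf (gauss_density z).
Proof.
(* The fundamental theorem of calculus is applied on ]-oo, z + 1], of which z is an interior
   point. *)
have zz : z < z + 1 by rewrite ltrDl.
have ip : (@lebesgue_measure R).-integrable [set` Interval -oo%O (BRight (z + 1))]
    (EFin \o normal_pdf (0 : R) 1).
  apply: (integrableS _ _ (@subsetT _ _)) => //.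
  exact: integrable_normal_pdf.
have [] := continuous_FTC1 zz ip (ltNyr _) (@continuous_normal_pdf R 0 1 (oner_neq0 _) z).
move=> d1 d2.
apply: DeriveDef; first exact: d1.
by rewrite -derive1E d2 gauss_densityE.
Qed.

Lemma normal_cdf_tails (e : R) : 0 < e ->
  exists M, forall y, M <= y -> 1 - normal_cdf y < e /\ normal_cdf (- y) < e.
Proof.
move=> e0; pose P := normal_prob (0 : R) 1.
have mid : (idfun : measurableTypeR R -> R) \in mfun.
  by rewrite inE; exact: measurable_id.
(* Under the Gaussian law the identity has [normal_cdf] as its distribution function, whose limits
   at both infinities are known. *)
pose Y : {RV P >-> R} := mfun_Sub mid.
have /fine_cvg/cvgrPdist_lt/(_ _ e0)[M [_ hM]] := cvg_cdfy1 Y.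
have /fine_cvg/cvgrPdist_lt/(_ _ e0)[m [_ hm]] := cvg_cdfNy0 Y.
exists (Num.max (M + 1) (1 - m)) => y; rewrite ge_max => /andP[My my]; split.
  by apply: le_lt_trans (ler_norm _) (hM y _); lra.
by have := hm (- y) ltac:(lra); rewrite /= sub0r normrN; apply: le_lt_trans (ler_norm _).
Qed.

(** The density is even, so Phi(z) + Phi(-z) has derivative zero; the tails identify the constant as
    1. *)
Lemma normal_cdfN z : normal_cdf (- z) = 1 - normal_cdf z.
Proof.
pose S := fun y => normal_cdf y + normal_cdf (- y).
have dS (y : R) : is_derive y 1 S 0.
  have h1 := is_derive_normal_cdf (- y).
  have h2 : is_derive y 1 (fun x : R => - x) (-1) by apply: is_derive_eq.
  have h3 := is_derive1_comp h1 h2.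
  have h4 := is_derive_normal_cdf y.
  have := is_deriveD h4 h3.
  by rewrite /gauss_density /GRing.scale /= sqrrN mulrN1 subrr.
have cS (u v : R) : u < v -> S v = S u.
  move=> uv; have [c _ /eqP] := mvt_everywhere uv dS.
  by rewrite mul0r subr_eq0 => /eqP.
have {}cS (u v : R) : S u = S v.
  by have [/cS//|/cS//|->] := ltgtP u v.
suff : `|S z - 1| <= 0 by rewrite normr_le0 subr_eq0 /S => /eqP <-; ring.
apply/ler_addgt0Pl => e e0; rewrite addr0.
have [M /(_ M (lexx M)) [h1 h2]] := normal_cdf_tails e0.
have := normal_cdf_le1 M; have := normal_cdf_ge0 (- M) => h3 h4.
by rewrite (cS z M) /S ler_norml; apply/andP; split; lra.
Qed.

(** The source of the constant sqrt(2 pi) / 4. Let h be the right side minus the left one. Then h(0)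
    = 0 and h' is the density times q, where q(0) = 0 and q' decreases on [0, +oo[. If h(z) < 0 for
    some z > 0, then q is negative somewhere before z and stays so; hence h decreases beyond z,
    although h >= -(1 - Phi), which tends to 0. *)
Lemma normal_cdf_mul_le z :
  normal_cdf z * (1 - normal_cdf z) <= expR (- (z ^+ 2 / 2)) / 4.
Proof.
wlog z0 : z / 0 <= z => [hw|].
  have [/hw//|/ltW z0] := leP 0 z.
  have := hw (- z); rewrite oppr_ge0 => /(_ z0).
  by rewrite normal_cdfN sqrrN; lra.
pose h y := expR (- (y ^+ 2 / 2)) / 4 - normal_cdf y * (1 - normal_cdf y).
pose q y := (2 * normal_cdf y - 1) - y * gauss_const / 4.
pose dq y := 2 * gauss_density y - gauss_const / 4.
have dh (y : R) : is_derive y 1 h (gauss_density y * q y).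
  have h1 := is_derive_expR_sqr y (-1).
  have h2 := is_derive_normal_cdf y.
  rewrite (_ : h = (4^-1 \*: (fun y : R => expR (-1 * (y ^+ 2 / 2))))
     - (normal_cdf * (cst 1 - normal_cdf))); last first.
    by apply/funext => x; rewrite /h !fctE /= mulN1r [_ *: _]mulrC.
  apply: is_derive_eq.
  rewrite /q /gauss_density /GRing.scale /= !mulN1r !fctE.
  have := gauss_const_gt0; set c := gauss_const => c0.
  by field; rewrite gt_eqF.
have dqE (y : R) : is_derive y 1 q (dq y).
  have h2 := is_derive_normal_cdf y.
  apply: is_derive_eq.
  by rewrite /dq /GRing.scale /=; ring.
have q0 : q 0 = 0.
  have := normal_cdfN 0; rewrite oppr0 /q mul0r; lra.
have h0 : h 0 = 0.
  have := normal_cdfN 0; rewrite oppr0 /h expr0n mul0r oppr0 expR0.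
  (* Phi(0) is generalised to c, which the symmetry relation forces to be 1/2. *)
  have [c -> _] : exists2 c, normal_cdf 0 = c & True by exists (normal_cdf (0 : R)).
  move=> hc; have -> : c = 2^-1 by lra.
  by field.
rewrite -subr_ge0 -/(h z) leNgt; apply/negP => hz.
have {}z0 : 0 < z.
  by rewrite lt_neqAle z0 andbT; apply: contraTneq hz => <-; rewrite h0 ltxx.
have [x /andP[x0 xz]] := mvt_everywhere z0 dh.
rewrite h0 !subr0 => hx.
have qx : q x < 0.
  rewrite -(pmulr_rlt0 _ (gauss_density_gt0 x)) -(pmulr_llt0 _ z0) -hx //.
have [e /andP[e0 ex]] := mvt_everywhere x0 dqE.
rewrite q0 !subr0 => qe.
have dqe : dq e < 0 by rewrite -(pmulr_llt0 _ x0) -qe.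
(* Beyond e, the derivative of q is at most its value at e, which is negative; so q stays negative
   from x on. *)
have qlt y : x <= y -> q y < 0.
  rewrite le_eqVlt => /predU1P[<-//|xy].
  have [c /andP[xc cy]] := mvt_everywhere xy dqE.
  have dqc : dq c <= dq e.
    rewrite lerD2r ler_pM2l// ler_pM2l ?invr_gt0 ?gauss_const_gt0//.
    rewrite ler_expR lerN2 ler_pM2r// lerXn2r ?nnegrE; lra.
  have : dq c * (y - x) <= 0 by rewrite mulr_le0_ge0; lra.
  lra.
have hlt y : z < y -> h y < h z.
  move=> zy; have [c /andP[zc cy]] := mvt_everywhere zy dh.
  have qc : q c < 0 by apply: qlt; lra.
  have : gauss_density c * q c * (y - z) < 0.
    by rewrite pmulr_llt0 ?subr_gt0// pmulr_rlt0 ?gauss_density_gt0.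
  lra.
(* Far enough out, h >= -(1 - Phi) > h(z), against the decrease of h beyond z. *)
have [M hM] := normal_cdf_tails (e := - h z) ltac:(lra).
pose y := Num.max M (z + 1).
have [//|hy _] := hM y; first by rewrite le_max lexx.
have : h y < h z by apply: hlt; rewrite lt_max ltrDl ltr01 orbT.
have : normal_cdf y * (1 - normal_cdf y) <= 1 - normal_cdf y.
  by rewrite ler_piMl ?subr_ge0 ?normal_cdf_le1.
have hE : h y = expR (- (y ^+ 2 / 2)) / 4 - normal_cdf y * (1 - normal_cdf y) by [].
move: hE (expR_ge0 (- (y ^+ 2 / 2))) hy; clear; lra.
Qed.

(** The right side minus the left one has derivative -(1 - Phi) <= 0, so it suffices that it is at
    least -e far out. There [normal_cdf_mul_le] gives 1 - Phi(y) <= exp(-y^2/2) / 2, whence y (1 -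
    Phi(y)) <= 1/y. *)
Lemma mills z : z * (1 - normal_cdf z) <= gauss_density z.
Proof.
pose g y := gauss_density y - y * (1 - normal_cdf y).
have dg (y : R) : is_derive y 1 g (- (1 - normal_cdf y)).
  have h1 := is_derive_gauss_density y.
  have h2 := is_derive_normal_cdf y.
  rewrite (_ : g = gauss_density - (id * (cst 1 - normal_cdf)))//.
  apply: is_derive_eq.
  rewrite /GRing.scale /= !fctE; ring.
rewrite -subr_ge0 -/(g z); apply/ler_addgt0Pl => e e0.
have gdec y : z < y -> g y <= g z.
  move=> zy; have [c _] := mvt_everywhere zy dg.
  have : 0 <= (1 - normal_cdf c) * (y - z).
    by rewrite mulr_ge0 ?subr_ge0 ?normal_cdf_le1// ltW.
  lra.
have [M hM] := normal_cdf_tails (e := 2^-1) ltac:(lra).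
(* The three entries ensure Phi(y) > 1/2, y > z and 1/y <= e. *)
pose y := Num.max (Num.max M (z + 1)) (e^-1).
have zy : z < y by rewrite !lt_max ltrDl ltr01 orbT.
have ey : e^-1 <= y by rewrite !le_max lexx orbT.
have [|h1 _] := hM y; first by rewrite !le_max lexx.
have y0 : 0 < y by rewrite (lt_le_trans _ ey)// invr_gt0.
have hy : (y ^+ 2 / 2) * expR (- (y ^+ 2 / 2)) <= 1.
  rewrite expRN ler_pdivrMr ?expR_gt0// mul1r.
  by apply: le_trans (expR_ge1Dx _); lra.
have h2 : y * (1 - normal_cdf y) <= e.
  have h3 := normal_cdf_mul_le y.
  have h4 : 1 - normal_cdf y <= expR (- (y ^+ 2 / 2)) / 2.
    have : 0 <= (normal_cdf y - 2^-1) * (1 - normal_cdf y).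
      by rewrite mulr_ge0 ?subr_ge0 ?normal_cdf_le1//; lra.
    lra.
  have : y * (1 - normal_cdf y) <= y^-1.
    rewrite -(ler_pM2l y0) mulfV ?gt_eqF//.
    have : (y ^+ 2) * (1 - normal_cdf y) <= (y ^+ 2) * (expR (- (y ^+ 2 / 2)) / 2).
      by rewrite ler_wpM2l// sqr_ge0.
    lra.
  move=> /le_trans; apply.
  by rewrite -[leRHS]invrK lef_pV2 ?posrE ?invr_gt0.
have := gdec _ zy; have := gauss_density_gt0 y; rewrite {1}/g; lra.
Qed.
End gaussian_density.

(** * The bounded solution of the Stein equation and its Taylor estimate *)

Section stein_solution.
Context {R : realType}.
Implicit Types x z : R.

(** This is exp(z^2/2) times the integral of exp(-t^2/2) over ]-oo, z], the solution of f' = z f + 1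
    that stays bounded at -oo. Its mirror image [stein_right] solves f' = z f - 1 and stays bounded
    at +oo. *)
Definition stein_left z : R := gauss_const * expR (z ^+ 2 / 2) * normal_cdf z.
Definition stein_right z : R := stein_left (- z).

Lemma stein_rightE z :
  stein_right z = gauss_const * expR (z ^+ 2 / 2) * (1 - normal_cdf z).
Proof. by rewrite /stein_right /stein_left sqrrN normal_cdfN. Qed.

Lemma gauss_densityK z : gauss_const * expR (z ^+ 2 / 2) * gauss_density z = 1.
Proof.
rewrite /gauss_density mulrACA mulfV ?gt_eqF ?gauss_const_gt0// mul1r.
by rewrite expRN mulfV// gt_eqF// expR_gt0.
Qed.

Let weight_gt0 z : 0 < gauss_const * expR (z ^+ 2 / 2).
Proof. by rewrite mulr_gt0 ?gauss_const_gt0 ?expR_gt0. Qed.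

Lemma stein_left_ge0 z : 0 <= stein_left z.
Proof. by rewrite mulr_ge0 ?normal_cdf_ge0 ?ltW. Qed.

Lemma is_derive_stein_left z : is_derive z 1 stein_left (z * stein_left z + 1).
Proof.
have h1 := is_derive_expR_sqr z 1.
have h2 := is_derive_normal_cdf z.
rewrite (_ : stein_left = (gauss_const \*: (fun y : R => expR (1 * (y ^+ 2 / 2))))
   * normal_cdf); last first.
  by apply/funext => y; rewrite !fctE /= mul1r.
apply: is_derive_eq.
rewrite !fctE /= /GRing.scale /= !mul1r gauss_densityK /stein_left; ring.
Qed.

Lemma is_derive_stein_right z :
  is_derive z 1 stein_right (z * stein_right z - 1).
Proof.
have h1 := is_derive_stein_left (- z).
have h2 : is_derive z 1 (fun y : R => - y) (-1) by apply: is_derive_eq.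
have := is_derive1_comp h1 h2.
by rewrite /GRing.scale /= mulrN1 opprD mulNr opprK.
Qed.

Lemma stein_right_le1 z : z * stein_right z <= 1.
Proof.
rewrite stein_rightE mulrCA -[leRHS](gauss_densityK z).
by rewrite ler_pM2l// mills.
Qed.

Lemma stein_left_le1 z : - z * stein_left z <= 1.
Proof. by have := stein_right_le1 (- z); rewrite /stein_right opprK. Qed.

Lemma stein_left_bound z : stein_left z * (1 - normal_cdf z) <= gauss_const / 4.
Proof.
rewrite /stein_left -mulrA.
apply: (@le_trans _ _ (gauss_const * expR (z ^+ 2 / 2) * (expR (- (z ^+ 2 / 2)) / 4))).
  by rewrite ler_pM2l// normal_cdf_mul_le.
rewrite expRN (_ : _ * _ = gauss_const / 4)//.
by field; rewrite gt_eqF ?expR_gt0.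
Qed.

Lemma normal_cdf_homo : {homo (@normal_cdf R) : x y / x <= y}.
Proof.
move=> x y; rewrite le_eqVlt => /predU1P[->//|xy].
have [c _] := mvt_everywhere xy (@is_derive_normal_cdf R).
have := gauss_density_gt0 c => c0.
have : 0 <= gauss_density c * (y - x) by rewrite mulr_ge0 ?subr_ge0 ?ltW.
lra.
Qed.

(* The solution of Stein's equation g'(z) - z g(z) = 1_{z <= x} - Phi(x); at
   z = x, where g has a kink, [stein_sol'] is the left derivative. *)
Definition stein_sol x z : R :=
  if z <= x then (1 - normal_cdf x) * stein_left z
  else normal_cdf x * stein_right z.

Definition stein_sol' x z : R :=
  z * stein_sol x z + (z <= x)%R%:R - normal_cdf x.

(** The two branches agree at z = x, so the right-hand formula extends to the kink. *)
Lemma stein_sol_right x z : x <= z ->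
  stein_sol x z = normal_cdf x * stein_right z.
Proof.
rewrite /stein_sol le_eqVlt => /predU1P[<-|xz].
  by rewrite lexx stein_rightE /stein_left; ring.
by rewrite leNgt xz.
Qed.

Lemma stein_sol_ge0 x z : 0 <= stein_sol x z.
Proof.
rewrite /stein_sol; case: ifP => _; rewrite mulr_ge0 ?stein_left_ge0//.
  by rewrite subr_ge0 normal_cdf_le1.
exact: normal_cdf_ge0.
Qed.

(** Monotonicity of Phi replaces x by z in the coefficient of either branch; this is the worst case,
    covered by [stein_left_bound]. *)
Lemma stein_sol_le x z : stein_sol x z <= gauss_const / 4.
Proof.
rewrite /stein_sol; case: (leP z x) => [zx|/ltW xz].
  rewrite mulrC (le_trans _ (stein_left_bound z))//.
  by rewrite ler_wpM2l ?stein_left_ge0// lerD2l lerN2 normal_cdf_homo.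
apply: le_trans (_ : stein_left (- z) * normal_cdf z <= _).
  by rewrite mulrC ler_wpM2l ?stein_left_ge0// normal_cdf_homo.
by have := stein_left_bound (- z); rewrite normal_cdfN opprB addrC subrK.
Qed.

Lemma stein_sol'_left x z : z <= x ->
  stein_sol' x z = (1 - normal_cdf x) * (z * stein_left z + 1).
Proof. by move=> zx; rewrite /stein_sol' /stein_sol zx mulr1n; ring. Qed.

Lemma stein_sol'_right x z : x < z ->
  stein_sol' x z = normal_cdf x * (z * stein_right z - 1).
Proof.
by move=> xz; rewrite /stein_sol' (stein_sol_right (ltW xz)) leNgt xz mulr0n; ring.
Qed.

(** For z <= 0 on the left branch, and for z >= 0 on the right one, both factors have absolute value
    at most 1. Otherwise x is replaced by z in the coefficient, [lE] exchanges the two solutions,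
    and Mills' inequality leaves Phi(z) + (1 - Phi(z)) = 1. *)
Lemma stein_sol'_le1 x z : `|stein_sol' x z| <= 1.
Proof.
have Px0 := normal_cdf_ge0 x; have Px1 := normal_cdf_le1 x.
have Pz0 := normal_cdf_ge0 z; have Pz1 := normal_cdf_le1 z.
have lE : stein_left z * (1 - normal_cdf z) = stein_right z * normal_cdf z.
  by rewrite stein_rightE /stein_left; ring.
have h1 := stein_left_le1 z; have h2 := stein_right_le1 z.
have [zx|xz] := leP z x.
  rewrite stein_sol'_left// ger0_norm; last by rewrite mulr_ge0; lra.
  have [z0|z0] := leP z 0.
    have : z * stein_left z <= 0 by rewrite mulr_le0_ge0 ?stein_left_ge0.
    by move=> ?; rewrite mulr_ile1//; lra.
  have zl0 : 0 <= z * stein_left z by rewrite mulr_ge0 ?stein_left_ge0 ?ltW.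
  apply: le_trans (_ : (1 - normal_cdf z) * (z * stein_left z + 1) <= _).
    by rewrite ler_wpM2r ?lerD2l ?lerN2 ?normal_cdf_homo//; lra.
  have : normal_cdf z * (z * stein_right z) <= normal_cdf z.
    by rewrite ler_piMr.
  rewrite mulrCA [normal_cdf z * _]mulrC -lE.
  lra.
rewrite stein_sol'_right// ler0_norm; last by rewrite mulr_ge0_le0; lra.
have [z0|z0] := leP 0 z.
  have : 0 <= z * stein_right z by rewrite mulr_ge0 ?stein_left_ge0.
  by move=> ?; rewrite -mulrN mulr_ile1//; lra.
have zr0 : z * stein_right z <= 0 by rewrite mulr_le0_ge0 ?stein_left_ge0 ?ltW.
rewrite -mulrN; apply: le_trans (_ : normal_cdf z * (- (z * stein_right z - 1)) <= _).
  by rewrite ler_wpM2r ?normal_cdf_homo 1?ltW//; lra.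
have : (1 - normal_cdf z) * (- z * stein_left z) <= 1 - normal_cdf z.
  by rewrite ler_piMr//; lra.
rewrite mulrCA [(1 - normal_cdf z) * _]mulrC lE.
lra.
Qed.

(** [stein_sol x] is not differentiable at x, so the interval is cut there: on each piece the
    solution coincides with a smooth function, and the two bounds add up. Slope k = 0 gives the
    Lipschitz bound, and the slope at the base point gives the Taylor estimate. *)
Lemma stein_sol_mvt_le x k (B dB : R -> R) (u v : R) : u <= v ->
  (forall t : R, is_derive t 1 B (dB t)) ->
  (forall t : R, u < t < v -> `|stein_sol' x t - k| <= dB t) ->
  `|stein_sol x v - stein_sol x u - k * (v - u)| <= B v - B u.
Proof.
move=> uv BE dBE.
have onL (a b : R) : u <= a -> a <= b -> b <= v -> b <= x ->
    `|stein_sol x b - stein_sol x a - k * (b - a)| <= B b - B a.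
  move=> ua ab bv bx.
  pose g t := (1 - normal_cdf x) * stein_left t - k * t.
  pose dg t := (1 - normal_cdf x) * (t * stein_left t + 1) - k.
  have gE (t : R) : is_derive t 1 g (dg t).
    have := is_derive_stein_left t => ?.
    by apply: is_derive_eq; rewrite /dg /GRing.scale /= mulr1.
  rewrite /stein_sol bx (le_trans ab bx).
  have := @ler_dist_derive R g dg B dB a b ab gE BE.
  rewrite (_ : g b - g a = (1 - normal_cdf x) * stein_left b -
      (1 - normal_cdf x) * stein_left a - k * (b - a)); last by rewrite /g; ring.
  apply=> t /andP[at_ tb]; rewrite /dg -stein_sol'_left; last first.
    by rewrite (le_trans (ltW tb)).
  by apply: dBE; rewrite (le_lt_trans ua at_) (lt_le_trans tb bv).
have onR (a b : R) : u <= a -> a <= b -> b <= v -> x <= a ->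
    `|stein_sol x b - stein_sol x a - k * (b - a)| <= B b - B a.
  move=> ua ab bv xa.
  pose g t := normal_cdf x * stein_right t - k * t.
  pose dg t := normal_cdf x * (t * stein_right t - 1) - k.
  have gE (t : R) : is_derive t 1 g (dg t).
    have := is_derive_stein_right t => ?.
    by apply: is_derive_eq; rewrite /dg /GRing.scale /= mulr1.
  rewrite !stein_sol_right ?(le_trans xa ab)//.
  have := @ler_dist_derive R g dg B dB a b ab gE BE.
  rewrite (_ : g b - g a = normal_cdf x * stein_right b -
      normal_cdf x * stein_right a - k * (b - a)); last by rewrite /g; ring.
  apply=> t /andP[at_ tb]; rewrite /dg -stein_sol'_right; last first.
    by rewrite (le_lt_trans xa).
  by apply: dBE; rewrite (le_lt_trans ua at_) (lt_le_trans tb bv).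
have [vx|/ltW xv] := leP v x; first exact: onL.
have [xu|/ltW ux] := leP x u; first exact: onR.
have := onL _ _ (lexx u) ux xv (lexx x).
have := onR _ _ ux xv (lexx v) (lexx x).
rewrite !ler_norml => /andP[? ?] /andP[? ?]; apply/andP; split; lra.
Qed.

Lemma stein_sol_lip x u v : `|stein_sol x v - stein_sol x u| <= `|v - u|.
Proof.
wlog uv : u v / u <= v => [hw|].
  by have [/hw//|/ltW/hw] := leP u v; rewrite distrC [leRHS]distrC.
have idE (t : R) : is_derive t 1 id (1 : R) by exact: is_derive_id.
have := @stein_sol_mvt_le x 0 id (cst 1) u v uv idE.
rewrite mul0r subr0 (ger0_norm (_ : 0 <= v - u)) ?subr_ge0//; apply=> t _.
by rewrite subr0 stein_sol'_le1.
Qed.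

(** The factor a goes with the increment of the solution and the solution at t with t - a, so the
    constant depends on the base point a alone. *)
Lemma stein_sol_mul_lip x a t :
  `|t * stein_sol x t - a * stein_sol x a| <=
  (`|a| + gauss_const / 4) * `|t - a|.
Proof.
rewrite (_ : _ - _ = a * (stein_sol x t - stein_sol x a) + (t - a) * stein_sol x t);
  last by ring.
rewrite (le_trans (ler_normD _ _))// !normrM mulrDl lerD//.
  by rewrite ler_wpM2l ?stein_sol_lip.
by rewrite mulrC ler_wpM2r// ger0_norm ?stein_sol_ge0 ?stein_sol_le.
Qed.

(** By Stein's equation the increment of g' is that of z g(z) plus a jump of the indicator. The
    former is at most linear in |t - a|; the latter occurs between a and t only if x separates a
    from b. *)
Lemma stein_sol_taylor x a b :
  `|stein_sol x b - stein_sol x a - stein_sol' x a * (b - a)| <=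
  (`|a| + gauss_const / 4) * ((b - a) ^+ 2 / 2)
  + `|b - a| * `|(a <= x)%R%:R - (b <= x)%R%:R|.
Proof.
set L := `|a| + _; set e := `|_%:R - _|.
have L0 : 0 <= L by rewrite addr_ge0// divr_ge0// ltW// gauss_const_gt0.
have key t : a <= t <= b \/ b <= t <= a ->
    `|stein_sol' x t - stein_sol' x a| <= L * `|t - a| + e.
  move=> tab.
  rewrite (_ : _ - _ = (t * stein_sol x t - a * stein_sol x a) +
     ((t <= x)%R%:R - (a <= x)%R%:R)); last by rewrite /stein_sol'; ring.
  rewrite (le_trans (ler_normD _ _))// lerD ?stein_sol_mul_lip// /e.
  case: (leP t x) => tx; case: (leP a x) => ax; case: (leP b x) => bx;
    rewrite /= ?subr0 ?sub0r ?subrr ?normrN ?normr0 ?normr1 ?ler01 ?lexx//;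
    exfalso; case: tab => /andP[]; lra.
have [ab|/ltW ba] := leP a b.
  (* A primitive of L |t - a| + e, the bound on the increment of g'; for b <= a its quadratic part
     changes sign. *)
  pose B t := L * ((t - a) ^+ 2 / 2) + e * t.
  have BE (t : R) : is_derive t 1 B (L * (t - a) + e).
    by apply: is_derive_eq; rewrite /GRing.scale /=; field.
  have := @stein_sol_mvt_le x (stein_sol' x a) B _ a b ab BE.
  rewrite (ger0_norm (_ : 0 <= b - a)) ?subr_ge0//.
  rewrite (_ : B b - B a = L * ((b - a) ^+ 2 / 2) + (b - a) * e); last by rewrite /B; ring.
  apply=> t /andP[at_ tb]; have := key t _; rewrite (ger0_norm (_ : 0 <= t - a)) ?subr_ge0 1?ltW//.
  by apply; left; rewrite !ltW.
pose B t := - (L * ((t - a) ^+ 2 / 2)) + e * t.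
have BE (t : R) : is_derive t 1 B (- (L * (t - a)) + e).
  by apply: is_derive_eq; rewrite /GRing.scale /=; field.
have := @stein_sol_mvt_le x (stein_sol' x a) B _ b a ba BE.
rewrite (ler0_norm (_ : b - a <= 0)) ?subr_le0//.
rewrite (_ : B a - B b = L * ((b - a) ^+ 2 / 2) + (- (b - a)) * e); last by rewrite /B; ring.
rewrite (_ : _ - _ - _ = - (stein_sol x b - stein_sol x a - stein_sol' x a * (b - a)));
  last by ring.
rewrite normrN; apply=> t /andP[bt ta].
have := key t (or_intror _); rewrite (ltW bt) (ltW ta) => /(_ isT).
by rewrite (ler0_norm (_ : t - a <= 0)) ?subr_le0 ?(ltW ta)// mulrN.
Qed.

End stein_solution.

(** * Mean-square convergence *)

Section second_moment.
Context d (T : measurableType d) (R : realType) (P : probability T R).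
Implicit Types f g : T -> R.
Local Open Scope ereal_scope.

Definition sq_moment f : \bar R := \int[P]_w ((f w) ^+ 2)%:E.

Definition sq_integrable f : Prop :=
  measurable_fun [set: T] f /\ sq_moment f < +oo.

Lemma sq_moment_ge0 f : 0 <= sq_moment f.
Proof. by apply: integral_ge0 => w _; rewrite lee_fin sqr_ge0. Qed.

Lemma sq_moment_fin_num f : sq_integrable f -> sq_moment f \is a fin_num.
Proof. by case=> _ fi; rewrite ge0_fin_numE ?sq_moment_ge0. Qed.

Lemma integral_prob_cst (c : R) : \int[P]_w c%:E = c%:E.
Proof.
rewrite integral_cst// [X in _ * X](_ : _ = 1) ?mule1//.
exact: probability_setT.
Qed.

Lemma measurable_sq f : measurable_fun [set: T] f ->
  measurable_fun [set: T] (fun w => (f w ^+ 2)%:E).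
Proof. by move=> mf; apply/measurable_EFinP; exact: measurable_funX. Qed.

(** The pointwise bound (f + g)^2 <= 2 f^2 + 2 g^2 stands in for the triangle inequality of the L^2
    norm and keeps every estimate linear in [sq_moment]. *)
Lemma sq_momentD f g : measurable_fun [set: T] f -> measurable_fun [set: T] g ->
  sq_moment (f \+ g)%R <= 2%:E * sq_moment f + 2%:E * sq_moment g.
Proof.
move=> mf mg; have mf2 := measurable_sq mf; have mg2 := measurable_sq mg.
rewrite /sq_moment -!ge0_integralZl_EFin//; last 2 first.
- by move=> w _; rewrite lee_fin sqr_ge0.
- by move=> w _; rewrite lee_fin sqr_ge0.
rewrite -ge0_integralD//; last 4 first.
- by move=> w _; rewrite -EFinM lee_fin mulr_ge0 ?sqr_ge0.
- exact: measurable_funeM.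
- by move=> w _; rewrite -EFinM lee_fin mulr_ge0 ?sqr_ge0.
- exact: measurable_funeM.
apply: ge0_le_integral => //.
- by move=> w _; rewrite lee_fin sqr_ge0.
- by apply: measurable_sq; exact: measurable_funD.
- by apply: emeasurable_funD; exact: measurable_funeM.
- move=> w _; rewrite -!EFinM -EFinD lee_fin /=.
  rewrite -subr_ge0 (_ : _ - _ = (f w - g w) ^+ 2)%R ?sqr_ge0//; ring.
Qed.

Lemma sq_momentZ (c : R) f : measurable_fun [set: T] f ->
  sq_moment (fun w => c * f w)%R = (c ^+ 2)%:E * sq_moment f.
Proof.
move=> mf; rewrite /sq_moment -ge0_integralZl_EFin ?sqr_ge0//.
- by apply: eq_integral => w _; rewrite exprMn EFinM.
- by move=> w _; rewrite lee_fin sqr_ge0.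
- exact: measurable_sq.
Qed.

Lemma sq_momentN f : sq_moment (fun w => - f w)%R = sq_moment f.
Proof. by apply: eq_integral => w _; rewrite sqrrN. Qed.

Lemma sq_momentB f g : measurable_fun [set: T] f -> measurable_fun [set: T] g ->
  sq_moment (f \- g)%R <= 2%:E * sq_moment f + 2%:E * sq_moment g.
Proof.
move=> mf mg; rewrite -[X in _ <= _ + _ * X]sq_momentN.
by apply: sq_momentD => //; exact: measurable_funN.
Qed.

Lemma sq_momentD_le f g (a b : R) :
  measurable_fun [set: T] f -> measurable_fun [set: T] g ->
  sq_moment f <= a%:E -> sq_moment g <= b%:E ->
  sq_moment (f \+ g)%R <= (2 * a + 2 * b)%:E.
Proof.
move=> mf mg fa gb; rewrite (le_trans (sq_momentD mf mg))//.
by rewrite (EFinD (2 * a)) (EFinM 2 a) (EFinM 2 b) leeD// lee_wpmul2l.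
Qed.

Lemma sq_momentB_le f g (a b : R) :
  measurable_fun [set: T] f -> measurable_fun [set: T] g ->
  sq_moment f <= a%:E -> sq_moment g <= b%:E ->
  sq_moment (f \- g)%R <= (2 * a + 2 * b)%:E.
Proof.
move=> mf mg fa gb; rewrite (le_trans (sq_momentB mf mg))//.
by rewrite (EFinD (2 * a)) (EFinM 2 a) (EFinM 2 b) leeD// lee_wpmul2l.
Qed.

Lemma ae_eq_sq_moment f g : measurable_fun [set: T] f ->
  measurable_fun [set: T] g -> {ae P, forall w, f w = g w} ->
  sq_moment f = sq_moment g.
Proof.
move=> mf mg fg; apply: ae_eq_integral => //; [exact: measurable_sq..|].
by apply: filterS fg => w -> _.
Qed.

Lemma le_sq_moment f g : measurable_fun [set: T] f ->
  measurable_fun [set: T] g -> (forall w, (f w ^+ 2 <= g w ^+ 2)%R) ->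
  sq_moment f <= sq_moment g.
Proof.
move=> mf mg fg; apply: ge0_le_integral => //; [| exact: measurable_sq..|].
  by move=> w _; rewrite lee_fin sqr_ge0.
by move=> w _; rewrite lee_fin.
Qed.

Lemma sq_integrableD f g :
  sq_integrable f -> sq_integrable g -> sq_integrable (f \+ g)%R.
Proof.
move=> [mf fi] [mg gi]; split; first exact: measurable_funD.
rewrite (le_lt_trans (sq_momentD mf mg))// lte_add_pinfty//.
  by rewrite lte_mul_pinfty.
by rewrite lte_mul_pinfty.
Qed.

Lemma sq_integrableZ (c : R) f :
  sq_integrable f -> sq_integrable (fun w => c * f w)%R.
Proof.
move=> [mf fi]; split; first exact: measurable_funM.
by rewrite sq_momentZ// lte_mul_pinfty// lee_fin sqr_ge0.
Qed.

Lemma sq_integrableN f : sq_integrable f -> sq_integrable (fun w => - f w)%R.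
Proof.
by move=> [mf fi]; split; [exact: measurable_funN|rewrite sq_momentN].
Qed.

Lemma sq_integrableB f g :
  sq_integrable f -> sq_integrable g -> sq_integrable (f \- g)%R.
Proof. by move=> fi /sq_integrableN; exact: sq_integrableD. Qed.

Lemma sq_integrable_bounded (c : R) f : measurable_fun [set: T] f ->
  (forall w, (`|f w| <= c)%R) -> sq_integrable f.
Proof.
move=> mf fc; split => //.
apply: (@le_lt_trans _ _ (\int[P]_w (c ^+ 2)%:E)); last first.
  by rewrite integral_prob_cst ltry.
apply: ge0_le_integral => //; [|exact: measurable_sq|].
- by move=> w _; rewrite lee_fin sqr_ge0.
- move=> w _; rewrite lee_fin -real_normK ?num_real// lerXn2r ?nnegrE//.
  exact: le_trans (fc w).
Qed.

Lemma sq_integrable_cst (c : R) : sq_integrable (fun=> c).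
Proof. by apply: (@sq_integrable_bounded `|c|%R). Qed.

Lemma sq_integrable_sum I (s : seq I) (p : pred I) (F : I -> T -> R) :
  (forall i, p i -> sq_integrable (F i)) ->
  sq_integrable (fun w => \sum_(i <- s | p i) F i w)%R.
Proof.
move=> Fi; elim: s => [|i s ih].
  under eq_fun do rewrite big_nil; exact: sq_integrable_cst.
case pi : (p i); under eq_fun do rewrite big_cons pi; last exact: ih.
exact: sq_integrableD (Fi _ pi) ih.
Qed.

Lemma sq_integrable_mul f g : sq_integrable f -> sq_integrable g ->
  P.-integrable [set: T] (fun w => (f w * g w)%:E).
Proof.
move=> [mf fi] [mg gi]; apply/integrableP; split.
  by apply/measurable_EFinP; exact: measurable_funM.
apply: (@le_lt_trans _ _ (\int[P]_w (((f w) ^+ 2)%:E + ((g w) ^+ 2)%:E))).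
  apply: ge0_le_integral => //.
  - apply: measurableT_comp => //; apply/measurable_EFinP; exact: measurable_funM.
  - by apply: emeasurable_funD; exact: measurable_sq.
  - move=> w _; rewrite -EFinD abse_EFin lee_fin normrM.
    rewrite -(real_normK (num_real (f w))) -(real_normK (num_real (g w))).
    by have := sqr_ge0 (`|f w| - `|g w|)%R; have := sqr_ge0 (`|f w| + `|g w|)%R; nra.
rewrite ge0_integralD//; [exact: lte_add_pinfty|..].
- by move=> w _; rewrite lee_fin sqr_ge0.
- exact: measurable_sq.
- by move=> w _; rewrite lee_fin sqr_ge0.
- exact: measurable_sq.
Qed.

Lemma sq_integrable_integrable f : sq_integrable f ->
  P.-integrable [set: T] (EFin \o f).
Proof.
move=> /sq_integrable_mul/(_ (sq_integrable_cst 1)).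
by apply: eq_integrable => // w _; rewrite mulr1.
Qed.

Lemma sq_moment_eq0 f : measurable_fun [set: T] f ->
  sq_moment f = 0 -> {ae P, forall w, f w = 0%R}.
Proof.
move=> mf f0.
have : ae_eq P setT (fun w => ((f w) ^+ 2)%:E) (cst 0).
  apply/ae_eq_integral_abs => //; first exact: measurable_sq.
  rewrite -[RHS]f0; apply: eq_integral => w _.
  by rewrite abse_EFin ger0_norm ?sqr_ge0.
by apply: filterS => w /(_ I) [/eqP]; rewrite sqrf_eq0 => /eqP.
Qed.

(** Stands in for the Cauchy-Schwarz inequality, by |t| <= e + t^2 / e: a second moment at most e^2
    gives a first absolute moment at most 2 e. *)
Lemma abs_integral_le (e : R) f : (0 < e)%R -> measurable_fun [set: T] f ->
  \int[P]_w `|f w|%:E <= e%:E + e^-1%:E * sq_moment f.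
Proof.
move=> e0 mf; have mf2 := measurable_sq mf.
rewrite -[X in X + _]integral_prob_cst.
rewrite /sq_moment -ge0_integralZl_EFin ?invr_ge0 ?(ltW e0)//; last first.
  by move=> w _; rewrite lee_fin sqr_ge0.
rewrite -ge0_integralD//; last 3 first.
- by move=> w _; rewrite lee_fin ltW.
- by move=> w _; rewrite -EFinM lee_fin mulr_ge0 ?sqr_ge0// invr_ge0 ltW.
- exact: measurable_funeM.
apply: ge0_le_integral => //.
- by apply/measurable_EFinP; exact: measurableT_comp.
- by apply: emeasurable_funD => //; exact: measurable_funeM.
- move=> w _; rewrite -EFinM -EFinD lee_fin.
  rewrite -(ler_pM2l e0) mulrDr mulrA mulfV ?gt_eqF// mul1r.
  rewrite -(real_normK (num_real (f w))).
  by have := sqr_ge0 (`|f w| - e)%R; have := sqr_ge0 (`|f w|)%R; have := normr_ge0 (f w); nra.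
Qed.

(* Convergence in L^2, in a form free of extended-real square roots. *)
Definition sq_cvg (u : nat -> T -> R) (Y : T -> R) : Prop :=
  forall e : R, (0 < e)%R ->
    exists n0, forall n, (n0 <= n)%N -> sq_moment (u n \- Y)%R <= e%:E.

Lemma sq_cvg_ext u v Y Z :
  (forall n, measurable_fun [set: T] (u n)) -> measurable_fun [set: T] Y ->
  (forall n, measurable_fun [set: T] (v n)) -> measurable_fun [set: T] Z ->
  (exists m, forall n, (m <= n)%N -> {ae P, forall w, u n w = v n w}) ->
  {ae P, forall w, Y w = Z w} ->
  sq_cvg u Y -> sq_cvg v Z.
Proof.
move=> mu mY mv mZ [m uv] YZ uY e e0; have [n0 h] := uY e e0.
exists (maxn m n0) => n; rewrite geq_max => /andP[mn n0n].
rewrite (le_trans _ (h _ n0n))// le_eqVlt; apply/orP; left; apply/eqP.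
apply: ae_eq_sq_moment; [exact: measurable_funB..|].
by apply: filterS2 (uv _ mn) YZ => w /= -> ->.
Qed.

Lemma sq_cvg_unique u Y Z :
  (forall n, measurable_fun [set: T] (u n)) -> measurable_fun [set: T] Y ->
  measurable_fun [set: T] Z -> sq_cvg u Y -> sq_cvg u Z ->
  {ae P, forall w, Y w = Z w}.
Proof.
move=> mu mY mZ uY uZ.
suff : {ae P, forall w, (Y \- Z)%R w = 0%R}.
  by apply: filterS => w /= /eqP; rewrite subr_eq0 => /eqP.
apply: sq_moment_eq0; first exact: measurable_funB.
apply/eqP; rewrite eq_le sq_moment_ge0 andbT; apply/lee_addgt0Pr => e e0.
have e4 : (0 < e / 4)%R by rewrite divr_gt0.
have [n0 h0] := uY _ e4; have [n1 h1] := uZ _ e4.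
have {}h0 := h0 (maxn n0 n1) (leq_maxl _ _).
have {}h1 := h1 (maxn n0 n1) (leq_maxr _ _).
set n := maxn n0 n1 in h0 h1.
have -> : (Y \- Z = (u n \- Z) \- (u n \- Y))%R by apply/funext => w /=; ring.
apply: le_trans (sq_momentB_le _ _ h1 h0) _; [exact: measurable_funB..|].
by rewrite add0e lee_fin; lra.
Qed.

Lemma sq_cvgD u v Y Z :
  (forall n, measurable_fun [set: T] (u n)) -> measurable_fun [set: T] Y ->
  (forall n, measurable_fun [set: T] (v n)) -> measurable_fun [set: T] Z ->
  sq_cvg u Y -> sq_cvg v Z -> sq_cvg (fun n => u n \+ v n)%R (Y \+ Z)%R.
Proof.
move=> mu mY mv mZ uY vZ e e0.
have e4 : (0 < e / 4)%R by rewrite divr_gt0.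
have [n0 h0] := uY _ e4; have [n1 h1] := vZ _ e4.
exists (maxn n0 n1) => n; rewrite geq_max => /andP[/h0 {}h0 /h1 {}h1].
have -> : ((u n \+ v n) \- (Y \+ Z) = (u n \- Y) \+ (v n \- Z))%R.
  by apply/funext => w /=; ring.
apply: le_trans (sq_momentD_le _ _ h0 h1) _; [exact: measurable_funB..|].
by rewrite lee_fin; lra.
Qed.

Lemma sq_cvg_map (L : (T -> R) -> T -> R) (C : R) u Y :
  (0 <= C)%R -> (forall f g, L (f \- g)%R = (L f \- L g)%R) ->
  (forall f, sq_integrable f -> sq_moment (L f) <= C%:E * sq_moment f) ->
  (forall n, sq_integrable (u n)) -> sq_integrable Y ->
  sq_cvg u Y -> sq_cvg (fun n => L (u n)) (L Y).
Proof.
move=> C0 LB LC ui Yi uY e e0.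
(* C + 1 instead of C, which may be zero. *)
have e' : (0 < e / (C + 1))%R by rewrite divr_gt0// ltr_wpDl.
have [n0 h] := uY _ e'; exists n0 => n /h {}h.
rewrite -LB; apply: le_trans (LC _ (sq_integrableB (ui n) Yi)) _.
apply: le_trans (lee_wpmul2l _ h) _; rewrite ?lee_fin// mulrC -mulrA.
by rewrite ler_piMr ?(ltW e0)// mulrC ler_pdivrMr ?ltr_wpDl// mul1r lerDl.
Qed.

Lemma sq_cvgZ (c : R) u Y : (forall n, sq_integrable (u n)) -> sq_integrable Y ->
  sq_cvg u Y -> sq_cvg (fun n w => c * u n w)%R (fun w => c * Y w)%R.
Proof.
apply: (@sq_cvg_map (fun f w => c * f w)%R (c ^+ 2)) => //; first exact: sqr_ge0.
  by move=> f g; apply/funext => w /=; rewrite mulrBr.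
by move=> f [mf _]; rewrite sq_momentZ.
Qed.

Lemma sq_cvg_cst Y : sq_cvg (fun=> Y) Y.
Proof.
move=> e e0; exists 0%N => n _.
rewrite /sq_moment (_ : (fun _ => _) = cst 0) ?integral0 ?lee_fin ?ltW//.
by apply/funext => w /=; rewrite subrr expr0n.
Qed.

Lemma sq_cvg_sum I (s : seq I) (u : I -> nat -> T -> R) (Y : I -> T -> R) :
  (forall i n, sq_integrable (u i n)) -> (forall i, sq_integrable (Y i)) ->
  (forall i, sq_cvg (u i) (Y i)) ->
  sq_cvg (fun n w => \sum_(i <- s) u i n w)%R (fun w => \sum_(i <- s) Y i w)%R.
Proof.
move=> ui Yi uY; elim: s => [|i s ih].
  rewrite (_ : (fun n w => _) = fun _ _ => 0)%R; last first.
    by apply/funext => n; apply/funext => w; rewrite big_nil.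
  rewrite (_ : (fun w => _) = fun=> 0)%R; last first.
    by apply/funext => w; rewrite big_nil.
  exact: sq_cvg_cst.
rewrite (_ : (fun n w => _) =
    fun n => u i n \+ (fun w => \sum_(j <- s) u j n w))%R; last first.
  by apply/funext => n; apply/funext => w; rewrite big_cons.
rewrite (_ : (fun w => _) = Y i \+ (fun w => \sum_(j <- s) Y j w))%R; last first.
  by apply/funext => w; rewrite big_cons.
apply: sq_cvgD => //.
- by move=> n; case: (ui i n).
- by case: (Yi i).
- by move=> n; apply: (sq_integrable_sum _ (p := xpredT) _).1.
- by apply: (sq_integrable_sum _ (p := xpredT) _).1.
Qed.

End second_moment.

(** * Agreement of second moments with the library's space L^2 *)

Section Lfun2.
Context d (T : measurableType d) (R : realType) (P : probability T R).
Implicit Types f g : T -> R.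
Local Open Scope ereal_scope.

Lemma Lnorm2E f : 'N[P]_2%:E[EFin \o f] = sq_moment P f `^ 2^-1.
Proof.
rewrite unlock /Lnorm; congr (_ `^ _); apply: eq_integral => w _.
by rewrite abse_EFin poweR_EFin powR_mulrn// real_normK ?num_real.
Qed.

Lemma Lfun2P f : f \in Lfun P 2%:E <-> sq_integrable P f.
Proof.
rewrite inE; split.
  move=> /andP[]; rewrite !inE/= /finite_norm Lnorm2E => mf fi; split => //.
  by apply: lty_poweRy fi; rewrite gt_eqF.
move=> [mf fi]; apply/andP; rewrite !inE/= /finite_norm Lnorm2E; split => //.
exact: poweR_lty.
Qed.

Lemma sq_cvgP (u : nat -> T -> R) (Y : T -> R) :
  (forall n, sq_integrable P (u n)) -> sq_integrable P Y ->
  'N[P]_2%:E[EFin \o (u n \- Y)%R] @[n --> \oo] --> 0 <-> sq_cvg P u Y.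
Proof.
move=> ui Yi.
pose r n := fine (sq_moment P (u n \- Y)%R).
have rE n : sq_moment P (u n \- Y)%R = (r n)%:E.
  by rewrite fineK// sq_moment_fin_num//; exact: sq_integrableB.
have r0 n : (0 <= r n)%R by rewrite -lee_fin -rE sq_moment_ge0.
rewrite (_ : (fun n => _) = (fun n => (Num.sqrt (r n))%:E)); last first.
  by apply/funext => n; rewrite Lnorm2E rE poweR_EFin powR12_sqrt.
split.
  move=> /fine_cvgP[_ /cvgrPdist_lt h] e e0.
  have se0 : (0 < Num.sqrt e)%R by rewrite sqrtr_gt0.
  have [n0 _ hn] := h _ se0; exists n0 => n /hn /=.
  rewrite sub0r normrN ger0_norm ?sqrtr_ge0// ltr_sqrt// => rn.
  by rewrite rE lee_fin ltW.
move=> h; apply/fine_cvgP; split; first exact: nearW.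
apply/cvgrPdist_lt => e e0.
have e2 : (0 < e ^+ 2 / 2)%R by rewrite divr_gt0// exprn_gt0.
have [n0 hn] := h _ e2.
exists n0 => // n /hn /=.
rewrite rE lee_fin sub0r normrN ger0_norm ?sqrtr_ge0// => hr.
rewrite -(ger0_norm (ltW e0)) -sqrtr_sqr ltr_sqrt ?exprn_gt0//.
by rewrite (le_lt_trans hr)// ltr_pdivrMr// ltr_pMr ?exprn_gt0// ltr1n.
Qed.

End Lfun2.

Section completeness.
Context d (T : measurableType d) (R : realType) (P : probability T R).
Local Open Scope ereal_scope.

Lemma limn_einf_le (u : (\bar R)^nat) (c : \bar R) (m : nat) :
  (forall k, (m <= k)%N -> u k <= c) -> limn_einf u <= c.
Proof.
move=> uc; rewrite limn_einf_lim; apply: lime_le; first exact: is_cvg_einfs.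
apply: nearW => n; rewrite (le_trans _ (uc (maxn n m) (leq_maxr _ _)))//.
by apply: ereal_inf_lbound; exists (maxn n m) => //=; exact: leq_maxl.
Qed.

(* Riesz-Fischer: a rapidly convergent subsequence converges almost everywhere,
   and its pointwise limit is the limit in mean square by Fatou's lemma. *)
Lemma sq_complete (u : nat -> T -> R) :
  (forall n, sq_integrable P (u n)) ->
  (forall e : R, (0 < e)%R -> exists n0, forall m n, (n0 <= m)%N -> (n0 <= n)%N ->
     sq_moment P (u m \- u n)%R <= e%:E) ->
  exists2 Y, sq_integrable P Y & sq_cvg P u Y.
Proof.
move=> ui uC.
have mu n : measurable_fun setT (u n) by case: (ui n).
pose a k : R := ((2 ^ k.+1)%:R^-1)%R.
have a0 k : (0 < a k)%R by rewrite invr_gt0 ltr0n expn_gt0.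
have [N hN] := choice (fun k => uC _ (exprn_gt0 2 (a0 k))).
(* The maximum makes s k at least k and at least N j for every j <= k, so that s k and s k.+1 both
   lie beyond N k. *)
pose s k := (\max_(j < k.+1) maxn j (N j))%N.
have sle (j k : nat) : (j < k.+1)%N -> (maxn j (N j) <= s k)%N.
  by move=> jk; exact: (@leq_bigmax _ (fun i : 'I_k.+1 => maxn i (N i)) (Ordinal jk)).
have Ns k : (N k <= s k)%N by rewrite (leq_trans _ (sle _ _ (ltnSn k)))// leq_maxr.
have s1 k : (N k <= s k.+1)%N.
  by rewrite (leq_trans _ (sle k k.+1 _))// leq_maxr.
have sk k : (k <= s k)%N by rewrite (leq_trans _ (sle _ _ (ltnSn k)))// leq_maxl.
pose v k := u (s k).
pose dv k w : R := (`|v k.+1 w - v k w|)%R.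
have mdv k : measurable_fun setT (fun w => (dv k w)%:E).
  apply/measurable_EFinP; rewrite /dv.
  by apply: measurableT_comp => //; exact: (measurable_funB (mu _) (mu _)).
(* The second moment of the increment is at most (a k)^2, so its first absolute moment is at most 2
   a k, which is summable. *)
have idv k : \int[P]_w (dv k w)%:E <= (2 / (2 ^ k.+1)%:R)%:E.
  apply: le_trans (abs_integral_le P (a0 k) (measurable_funB (mu _) (mu _))) _.
  apply: le_trans (leeD (lexx _) (lee_wpmul2l _ (hN k _ _ (s1 k) (Ns k)))) _.
    by rewrite lee_fin invr_ge0 ltW.
  by rewrite -EFinM -EFinD lee_fin /a exprS expr1 mulKf ?gt_eqF//; lra.
pose S w : \bar R := \sum_(0 <= k <oo) (dv k w)%:E.
have S0 w : 0 <= S w by apply: nneseries_ge0 => k _ _; rewrite lee_fin normr_ge0.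
have mS : measurable_fun setT S.
  by apply: ge0_emeasurable_sum => // k w _ _; rewrite lee_fin normr_ge0.
have iS : P.-integrable setT S.
  apply/integrableP; split => //.
  under eq_integral do rewrite gee0_abs//.
  rewrite /S integral_nneseries//; last by move=> k w _; rewrite lee_fin normr_ge0.
  apply: (@le_lt_trans _ _ 2%:E); last exact: ltry.
  apply: le_trans (_ : \sum_(0 <= k <oo) (2 / (2 ^ k.+1)%:R)%:E <= _).
    apply: lee_nneseries => k _ => [_|]; last exact: idv.
    by apply: integral_ge0 => w _; rewrite lee_fin normr_ge0.
  exact: epsilon_trick0.
pose A := [set w | S w < +oo].
have mA : measurable A.
  by rewrite -[A]setTI; exact: emeasurable_fun_infty_o.
have aeA : {ae P, forall w, A w}.
  by apply: filterS (integrable_ae measurableT iS) => w /(_ I); rewrite /A /= ge0_fin_numE.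
(* Cutting v k off outside A makes the limit exist at every point, hence measurable, and changes v k
   only on a null set. *)
pose vA k w : R := (v k w * \1_A w)%R.
have vAc w : cvgn (vA ^~ w).
  have [wA|wA] := pselect (A w); last first.
    rewrite (_ : vA ^~ w = cst 0%R); first exact: is_cvg_cst.
    by apply/funext => k; rewrite /vA indicE memNset// mulr0.
  rewrite (_ : vA ^~ w = v ^~ w); last first.
    by apply/funext => k; rewrite /vA indicE mem_set// mulr1.
  have : cvgn (series (fun k => v k.+1 w - v k w)%R).
    apply: normed_cvg; apply: nnseries_is_cvg => // k; exact: normr_ge0.
  rewrite (_ : series _ = fun k => v k w - v 0%N w)%R; last first.
    by apply/funext => k; rewrite /series /= telescope_sumr.
  move=> h; rewrite (_ : v ^~ w = fun k => (v k w - v 0%N w) + v 0%N w)%R.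
    by apply: is_cvgD => //; exact: is_cvg_cst.
  by apply/funext => k; rewrite subrK.
have mvA k : measurable_fun setT (vA k).
  exact: (measurable_funM (mu _) (measurable_indic mA)).
pose Y w : R := limn (vA ^~ w).
have mY : measurable_fun setT Y by apply: (measurable_fun_cvg mvA) => w _; exact: vAc.
have uY : sq_cvg P u Y.
  move=> e e0; have [n0 h] := uC e e0; exists n0 => n n0n.
  rewrite /sq_moment (_ : (fun w => _) =
      fun w => limn_einf (fun k => ((u n w - vA k w) ^+ 2)%:E)); last first.
    apply/funext => w.
    suff /cvg_limn_einf_sup[-> _] : ((u n w - vA k w) ^+ 2)%:E @[k --> \oo] -->
       ((u n w - Y w) ^+ 2)%:E by [].
    apply: cvg_EFin; first exact: nearW.
    rewrite /comp /= expr2; under eq_fun do rewrite expr2.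
    have c1 : (u n w - vA k w)%R @[k --> \oo] --> (u n w - Y w)%R.
      by apply: cvgB; [exact: cvg_cst|exact: vAc].
    exact: cvgM.
  apply: le_trans (fatou P measurableT _ _) _.
  - by move=> k; apply: measurable_sq; exact: measurable_funB.
  - by move=> k w _; rewrite lee_fin sqr_ge0.
  apply: (limn_einf_le (m := n0)) => k n0k.
  rewrite (_ : \int[P]_w _ = sq_moment P (u n \- v k)%R); last first.
    apply: (@ae_eq_sq_moment _ _ _ P (u n \- vA k)%R (u n \- v k)%R).
    - exact: (measurable_funB (mu _) (mvA _)).
    - exact: (measurable_funB (mu _) (mu _)).
    - by apply: filterS aeA => w wA /=; rewrite /vA indicE mem_set// mulr1.
  by apply: h => //; exact: leq_trans (sk k).
exists Y => //.
have [n0 /(_ n0 (leqnn _)) hn] := uY 1%R ltr01.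
have -> : Y = (u n0 \- (u n0 \- Y))%R by apply/funext => w /=; ring.
apply: sq_integrableB => //; split; first exact: measurable_funB.
by rewrite (le_lt_trans hn)// ltry.
Qed.

End completeness.

Section integral_without_measurability.
Import HBNNSimple.
Context d (T : measurableType d) (R : realType) (mu : {measure set T -> \bar R}).
Local Open Scope ereal_scope.

(* The integral of a nonnegative function is a supremum over simple functions,
   hence monotone almost everywhere even without measurability. *)
Lemma ge0_ae_le_integral (f g : T -> \bar R) :
  (forall w, 0 <= f w) -> (forall w, 0 <= g w) ->
  {ae mu, forall w, f w <= g w} ->
  \int[mu]_w f w <= \int[mu]_w g w.
Proof.
move=> f0 g0 [N [mN N0 fgN]]; rewrite !ge0_integralTE//.
apply: ge_ereal_sup => _ [h hf <-].
(* Restricting h to the complement of the null set keeps its integral and puts it below g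
   everywhere. *)
pose hN := proj_nnsfun h (measurableC mN).
rewrite (_ : sintegral mu h = sintegral mu hN); last first.
  rewrite -!integralT_nnsfun; apply: ae_eq_integral => //.
  - exact/measurable_EFinP.
  - exact/measurable_EFinP.
  - exists N; split => // w; apply: contra_notP => wN _.
    by rewrite /hN -mrestrict patchE mem_set.
apply: ereal_sup_ubound; exists hN => // w.
rewrite /hN -mrestrict patchE; case: ifPn => [/set_mem wN|_]; last exact: g0.
apply: le_trans (hf w) _; apply: contrapT => fg; apply: wN.
by apply: fgN => /=.
Qed.

Lemma ge0_ae_eq_integral (f g : T -> \bar R) :
  (forall w, 0 <= f w) -> (forall w, 0 <= g w) ->
  {ae mu, forall w, f w = g w} -> \int[mu]_w f w = \int[mu]_w g w.
Proof.
move=> f0 g0 fg; apply/eqP; rewrite eq_le.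
by rewrite !ge0_ae_le_integral//; apply: filterS fg => w ->.
Qed.

Lemma ae_eq_integralT (f g : T -> \bar R) :
  {ae mu, forall w, f w = g w} -> \int[mu]_w f w = \int[mu]_w g w.
Proof.
move=> fg; rewrite integralE [RHS]integralE.
by congr (_ - _); apply: ge0_ae_eq_integral => //; apply: filterS fg => w;
  rewrite ?funeposE ?funenegE => ->.
Qed.

End integral_without_measurability.

(** * Coordinate flips and Walsh functions *)

Section coordinate_flip.
Implicit Types (w : Omega) (k : nat).

Definition flip k w : Omega := fun i => if i == k then ~~ w i else w i.

Lemma flipK k : involutive (flip k).
Proof.
by move=> w; apply/funext => i; rewrite /flip; case: eqP => //; rewrite negbK.
Qed.

Lemma measurable_coord k b : measurable [set w : Omega | w k = b].
Proof. by apply: sub_sigma_algebra; exists k, b. Qed.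

Lemma measurable_Omega_map (phi : Omega -> Omega) :
  (forall k b, measurable [set w | phi w k = b]) ->
  measurable_fun [set: Omega] phi.
Proof.
move=> h.
refine (@measurability _ _ Omega Omega setT phi coord_events _ _) => //.
by move=> _ [_ [k [b ->]] <-]; rewrite setTI; exact: h.
Qed.

Lemma measurable_flip k : measurable_fun [set: Omega] (flip k).
Proof.
apply: measurable_Omega_map => i b; rewrite /flip; case: eqP => _; last exact: measurable_coord.
rewrite (_ : [set w | _] = [set w : Omega | w i = ~~ b]); first exact: measurable_coord.
by apply/seteqP; split => w /= => [<-|->]; rewrite negbK.
Qed.

Lemma measurable_set_coord k b : measurable_fun [set: Omega] (set_coord k b).
Proof.
apply: measurable_Omega_map => i c; rewrite /set_coord; case: eqP => _; last exact: measurable_coord.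
have [->|bc] := eqVneq b c.
  by rewrite (_ : [set w | _] = setT)//; apply/seteqP; split.
rewrite (_ : [set w | _] = set0)//; apply/seteqP; split => w //= /eqP.
by rewrite (negbTE bc).
Qed.

Definition cylinder (n : nat) (A : nat -> set bool) : set Omega :=
  [set w | forall i, (i < n)%N -> A i (w i)].

Definition cylinders : set (set Omega) :=
  [set C | exists n A, C = cylinder n A].

Lemma measurable_cylinder n A : measurable (cylinder n A).
Proof.
rewrite (_ : cylinder n A = \bigcap_(i in `I_n) [set w : Omega | A i (w i)]); last first.
  by apply/seteqP; split => w /= h i; apply: h.
have mA i : measurable [set w : Omega | A i (w i)].
  rewrite (_ : [set w | _] = \bigcup_(b in A i) [set w : Omega | w i = b]); last first.
    by apply/seteqP; split => w /= => [|[b Ab ->//]]; exists (w i).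
  apply: fin_bigcup_measurable => [|b _]; last exact: measurable_coord.
  exact: finite_finset.
exact: fin_bigcap_measurable.
Qed.

Lemma setI_closed_cylinders : setI_closed cylinders.
Proof.
move=> _ _ [n [A ->]] [m [B ->]].
exists (maxn n m), (fun i => [set b | ((i < n)%N -> A i b) /\ ((i < m)%N -> B i b)]).
apply/seteqP; split => w /=.
  by move=> [hA hB] i _; split => ?; [exact: hA|exact: hB].
move=> h; split=> i il.
  by have [|+ _] := h i; [rewrite leq_max il|exact].
by have [|_] := h i; [rewrite leq_max il orbT|exact].
Qed.

Lemma sub_cylinders_coord : (@measurable _ Omega) `<=` <<s cylinders >>.
Proof.
apply: smallest_sub; first exact: smallest_sigma_algebra.
move=> _ [k [b ->]]; apply: sub_sigma_algebra.
exists k.+1, (fun i => if i == k then [set b] else setT).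
apply/seteqP; split => w /= => [<- i _|/(_ k (ltnSn k))]; last by rewrite eqxx.
by case: eqP => [->|].
Qed.

Context (R : realType) (P : probability Omega R).
Context (hP : is_rademacher_measure P).

Lemma bernoulli_half_negb (A : set bool) :
  bernoulli_prob (2^-1 : R) (negb @^-1` A) = bernoulli_prob (2^-1 : R) A.
Proof.
have half01 : 0 <= (2^-1 : R) <= 1 by rewrite invr_ge0 ler0n invf_le1// ler1n.
rewrite /bernoulli_prob half01.
have half b : bernoulli_pmf (2^-1 : R) b = 2^-1 by rewrite /bernoulli_pmf; case: b => //; lra.
rewrite [RHS](reindex_fsbig negb (negb @^-1` A))//; last first.
  split => //.
  - by move=> x y _ _; exact: negb_inj.
  - by move=> x Ax; exists (~~ x); rewrite /= ?negbK.
by apply: eq_fsbigr => b _; rewrite !half.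
Qed.

(** The two measures agree on cylinders, a pi-system that generates the sigma-algebra. The product
    rule for P enters all later arguments through this invariance. *)
Lemma flip_invariant k (A : set Omega) : measurable A ->
  pushforward P (flip k) A = P A.
Proof.
move=> /sub_cylinders_coord.
apply: (@g_sigma_algebra_measure_unique _ R Omega cylinders _ (fun=> setT) _ _
  (measure_function_pushforward__canonical__measure_function_Measure P (measurable_flip k)) P).
- by move=> _ [n [B ->]]; exact: measurable_cylinder.
- by move=> _; exists 0%N, (fun=> setT); apply/seteqP; split.
- by apply/seteqP; split => // w _; exists 0%N.
- exact: setI_closed_cylinders.
- move=> _ [n [B ->]] /=.
  rewrite /pushforward [X in P X](_ : _ =
    cylinder n (fun i => if i == k then negb @^-1` (B i) else B i)); last first.
    by apply/seteqP; split => w h i /h; rewrite /flip; case: eqP.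
  rewrite [LHS]hP [RHS]hP; apply: eq_bigr => i _; case: eqP => // _.
  exact: bernoulli_half_negb.
- by move=> _; rewrite /= /pushforward preimage_setT probability_setT ltry.
Qed.

End coordinate_flip.

(** * The pathwise gradient and integration by parts in one coordinate *)

Section rademacher_calculus.
Context {R : realType} (P : probability Omega R).
Context (hP : is_rademacher_measure P).
Implicit Types (F G : Omega -> R) (k : nat) (w : Omega).

Lemma measurable_comp_flip G k : measurable_fun [set: Omega] G ->
  measurable_fun [set: Omega] (fun w => G (flip k w)).
Proof. by move=> mG; apply: measurableT_comp mG (measurable_flip k). Qed.

Lemma integral_flip (f : Omega -> \bar R) k : measurable_fun [set: Omega] f ->
  (forall w, 0 <= f w)%E -> (\int[P]_w f (flip k w) = \int[P]_w f w)%E.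
Proof.
move=> mf f0.
rewrite -[RHS](@eq_measure_integral _ _ _ setT P
  (measure_function_pushforward__canonical__measure_function_Measure P (measurable_flip k)));
  last by move=> A mA _; exact: flip_invariant.
by rewrite ge0_integral_pushforward//; exact: measurable_flip.
Qed.

Lemma sq_moment_flip G k : measurable_fun [set: Omega] G ->
  sq_moment P (fun w => G (flip k w)) = sq_moment P G.
Proof.
move=> mG; apply: (integral_flip (f := fun w => ((G w) ^+ 2)%:E)).
  exact: measurable_sq.
by move=> w; rewrite lee_fin sqr_ge0.
Qed.

Lemma sq_integrable_flip G k : sq_integrable P G ->
  sq_integrable P (fun w => G (flip k w)).
Proof.
by move=> [mG Gi]; split; [exact: measurable_comp_flip|rewrite sq_moment_flip].
Qed.

Lemma Rintegral_flip f k : P.-integrable setT (EFin \o f) ->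
  \int[P]_w f (flip k w) = \int[P]_w f w.
Proof.
move=> fi; have mf := measurable_int _ fi.
rewrite /Rintegral; congr fine; rewrite integralE [RHS]integralE; congr (_ - _)%E.
  rewrite -(integral_flip k (measurable_funepos mf))//.
  by apply: eq_integral => w _; rewrite !funeposE.
rewrite -(integral_flip k (measurable_funeneg mf))//.
by apply: eq_integral => w _; rewrite !funenegE.
Qed.

Lemma Rintegral_flip_odd f k : P.-integrable setT (EFin \o f) ->
  (forall w, f (flip k w) = - f w) -> \int[P]_w f w = 0.
Proof.
move=> fi fodd; have := Rintegral_flip k fi.
under eq_Rintegral do rewrite fodd -mulN1r.
rewrite RintegralZl//; lra.
Qed.

Lemma measurable_rad k : measurable_fun [set: Omega] (@rad R k).
Proof.
rewrite (_ : @rad R k = fun w => 2 * \1_[set w : Omega | w k = true] w - 1).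
  apply: measurable_funB => //; apply: measurable_funM => //.
  by apply: measurable_indic; exact: measurable_coord.
apply/funext => w; rewrite /rad indicE.
case: ifPn => wk; first by rewrite mem_set//= mulr1n; lra.
by rewrite memNset ?mulr0n ?mulr0 ?sub0r//=; apply/negP.
Qed.

Lemma rad_sqr k w : @rad R k w * rad k w = 1.
Proof. by rewrite /rad; case: ifP => _; rewrite ?mulrNN mulr1. Qed.

Lemma norm_rad k w : `|@rad R k w| = 1.
Proof. by rewrite /rad; case: ifP => _; rewrite ?normrN normr1. Qed.

Lemma rad_flip i k w : @rad R i (flip k w) = (if i == k then - rad i w else rad i w).
Proof.
by rewrite /rad /flip; case: eqP => // _; case: (w i) => /=; rewrite ?opprK.
Qed.

Lemma sq_moment_rad k G : sq_moment P (fun w => rad k w * G w) = sq_moment P G.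
Proof. by apply: eq_integral => w _; rewrite exprMn expr2 rad_sqr mul1r. Qed.

Lemma sq_integrable_rad k G : sq_integrable P G ->
  sq_integrable P (fun w => rad k w * G w).
Proof.
move=> [mG Gi]; split; last by rewrite sq_moment_rad.
by apply: measurable_funM => //; exact: measurable_rad.
Qed.

(** Of the two points in the definition of the gradient, one is w and the other its flip; the sign
    X_k records which is which. *)
Lemma path_gradientE G k w :
  path_gradient G k w = rad k w * (G w - G (flip k w)) / 2.
Proof.
rewrite /path_gradient /rad.
have E1 : set_coord k (w k) w = w.
  by apply/funext => i; rewrite /set_coord; case: eqP => [->|].
have E2 : set_coord k (~~ w k) w = flip k w.
  by apply/funext => i; rewrite /set_coord /flip; case: eqP => [->|].
move: E1 E2; case: (w k) => /= -> ->; first by rewrite mul1r.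
by congr (_ / _); ring.
Qed.

Lemma path_gradient_flip G k w :
  path_gradient G k (flip k w) = path_gradient G k w.
Proof. by rewrite !path_gradientE flipK rad_flip eqxx; congr (_ / _); ring. Qed.

Lemma path_gradientB F G k :
  path_gradient (F \- G) k = path_gradient F k \- path_gradient G k.
Proof. by apply/funext => w; rewrite /path_gradient /=; field. Qed.

Lemma path_gradientZ (c : R) G k w :
  path_gradient (fun v => c * G v) k w = c * path_gradient G k w.
Proof. by rewrite /path_gradient; field. Qed.

Lemma path_gradient_sum I (r : seq I) (p : pred I) (G : I -> Omega -> R) k w :
  path_gradient (fun v => \sum_(i <- r | p i) G i v) k w =
  \sum_(i <- r | p i) path_gradient (G i) k w.
Proof.
by rewrite /path_gradient -sumrB mulr_suml.
Qed.

Lemma measurable_path_gradient G k : measurable_fun [set: Omega] G ->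
  measurable_fun [set: Omega] (path_gradient G k).
Proof.
move=> mG; rewrite /path_gradient; apply: measurable_funM => //.
by apply: measurable_funB; apply: measurableT_comp mG (measurable_set_coord _ _).
Qed.

(** D_k is a contraction of L^2: the two terms from [sq_momentB] are equal by flip invariance, and
    their factor 2 + 2 cancels the squared 1/2. *)
Lemma sq_moment_path_gradient G k : measurable_fun [set: Omega] G ->
  (sq_moment P (path_gradient G k) <= sq_moment P G)%E.
Proof.
move=> mG; have mGf := measurable_comp_flip k mG.
rewrite (_ : path_gradient G k =
  fun w => 2^-1 * (rad k w * (G \- (fun v => G (flip k v))) w)); last first.
  by apply/funext => w; rewrite path_gradientE mulrC.
rewrite sq_momentZ; last first.
  by apply: measurable_funM; [exact: measurable_rad|exact: measurable_funB].
rewrite sq_moment_rad.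
have := sq_momentB P mG mGf; rewrite (sq_moment_flip _ mG).
rewrite -ge0_muleDl ?lee_fin// -EFinD => h.
apply: le_trans (lee_wpmul2l _ h) _; first by rewrite lee_fin sqr_ge0.
rewrite muleA -EFinM (_ : _ * _ = 1) ?mul1e//; by field.
Qed.

Lemma sq_integrable_path_gradient G k : sq_integrable P G ->
  sq_integrable P (path_gradient G k).
Proof.
move=> [mG Gi]; split; first exact: measurable_path_gradient.
exact: le_lt_trans (sq_moment_path_gradient k mG) Gi.
Qed.

Lemma sq_cvg_path_gradient u Y k :
  (forall n, sq_integrable P (u n)) -> sq_integrable P Y ->
  sq_cvg P u Y -> sq_cvg P (fun n => path_gradient (u n) k) (path_gradient Y k).
Proof.
apply: (@sq_cvg_map _ _ _ _ (fun G => path_gradient G k) 1) => //.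
  by move=> F G; rewrite path_gradientB.
by move=> G [mG _]; rewrite mul1e; exact: sq_moment_path_gradient.
Qed.

(* Integration by parts in one coordinate: conditionally on the others, X_k is
   a fair sign. *)
Lemma Rintegral_rad_by_parts (V G : Omega -> R) k :
  sq_integrable P V -> sq_integrable P G -> (forall w, V (flip k w) = V w) ->
  \int[P]_w (rad k w * V w * G w) = \int[P]_w (V w * path_gradient G k w).
Proof.
move=> Vi Gi Vk.
have VGi := sq_integrable_mul (sq_integrable_rad k Vi) Gi.
have VGfi := sq_integrable_mul (sq_integrable_rad k Vi) (sq_integrable_flip k Gi).
(* Flipping coordinate k turns one integrand into minus the other, so the left-hand side is half the
   difference of the two integrals. *)
have E : \int[P]_w (rad k w * V w * G (flip k w)) =
    - \int[P]_w (rad k w * V w * G w).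
  rewrite -(Rintegral_flip k VGi) -mulN1r -RintegralZl//; last first.
    by have := sq_integrable_mul (sq_integrable_flip k (sq_integrable_rad k Vi))
      (sq_integrable_flip k Gi).
  by apply: eq_Rintegral => w _; rewrite rad_flip eqxx Vk; ring.
transitivity (2^-1 * (\int[P]_w (rad k w * V w * G w) -
   \int[P]_w (rad k w * V w * G (flip k w)))); first by rewrite E; field.
rewrite -RintegralB// -RintegralZl//; last first.
  by apply: (eq_integrable _ _ _ _ (integrableB _ VGi VGfi)).
by apply: eq_Rintegral => w _; rewrite path_gradientE /=; field.
Qed.

End rademacher_calculus.

(** * Walsh functions: orthonormality and coefficient multipliers *)

Section walsh.
Context {R : realType} (P : probability Omega R).
Context (hP : is_rademacher_measure P).
Implicit Types (s t : seq nat) (L : seq (seq nat)) (c : seq nat -> R).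

(** A finite index set is represented by its strictly increasing enumeration, so that equality of
    sets is equality of sequences; hence the [sorted ltn] hypotheses below. *)
Definition chi s (w : Omega) : R := \prod_(i <- s) rad i w.

Definition walsh L c (w : Omega) : R := \sum_(s <- L) c s * chi s w.

Lemma Rintegral_prob_cst (a : R) : \int[P]_w a = a.
Proof. by rewrite /Rintegral integral_prob_cst. Qed.

Lemma chi_sqr s w : chi s w * chi s w = 1.
Proof.
rewrite /chi -big_split /=; apply: big1_seq => i _; exact: rad_sqr.
Qed.

Lemma norm_chi s w : `|chi s w| = 1.
Proof. by rewrite /chi normr_prod big1// => i _; rewrite norm_rad. Qed.

Lemma chi_flip s k w : uniq s ->
  chi s (flip k w) = if k \in s then - chi s w else chi s w.
Proof.
elim: s => [|i s ih]; first by rewrite /chi !big_nil.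
move=> /= /andP[si us]; rewrite /chi !big_cons -!/(chi _ _) ih// rad_flip in_cons.
rewrite eq_sym; case: eqVneq => [->|_] /=; last by case: ifP => _; rewrite ?mulrN.
by rewrite (negbTE si) mulNr.
Qed.

Lemma measurable_chi s : measurable_fun [set: Omega] (chi s).
Proof.
elim: s => [|i s ih].
  rewrite (_ : chi [::] = cst 1); first exact: measurable_cst.
  by apply/funext => w; rewrite /chi big_nil.
rewrite (_ : chi (i :: s) = fun w => rad i w * chi s w); last first.
  by apply/funext => w; rewrite /chi big_cons.
by apply: measurable_funM => //; exact: measurable_rad.
Qed.

Lemma sq_integrable_chi s : sq_integrable P (chi s).
Proof.
apply: (sq_integrable_bounded _ (c := 1)); first exact: measurable_chi.
by move=> w; rewrite norm_chi.
Qed.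

Lemma path_gradient_chi s k w : uniq s ->
  path_gradient (chi s) k w = if k \in s then rad k w * chi s w else 0.
Proof.
move=> us; rewrite path_gradientE chi_flip//; case: ifP => _; first by field.
by rewrite subrr mulr0 mul0r.
Qed.

Lemma sorted_ltn_neq s t : sorted ltn s -> sorted ltn t -> s != t ->
  exists k, (k \in s) != (k \in t).
Proof.
move=> ss st /eqP st_neq; apply: contrapT => h; apply: st_neq.
apply: (irr_sorted_eq ltn_trans ltnn ss st) => k.
by apply/eqP; apply: contrapT => /negP ?; apply: h; exists k.
Qed.

Lemma sorted_ltn_uniq s : sorted ltn s -> uniq s.
Proof. exact: (sorted_uniq ltn_trans ltnn). Qed.

(** If s and t differ, some index lies in exactly one of them, and flipping it changes the sign of
    the product. *)
Lemma Rintegral_chi_mul s t : sorted ltn s -> sorted ltn t ->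
  \int[P]_w (chi s w * chi t w) = (s == t)%:R.
Proof.
move=> ss st; case: eqVneq => [->|st_neq].
  under eq_Rintegral do rewrite chi_sqr.
  by rewrite Rintegral_prob_cst.
have [k kst] := sorted_ltn_neq ss st st_neq.
apply: (Rintegral_flip_odd hP (k := k)).
  by apply: sq_integrable_mul; exact: sq_integrable_chi.
move=> w; rewrite !chi_flip ?sorted_ltn_uniq//.
by case: (k \in s) kst; case: (k \in t) => // _; rewrite ?mulrN ?mulNr.
Qed.

Lemma sq_integrable_walsh L c : sq_integrable P (walsh L c).
Proof.
apply: (sq_integrable_sum _ (p := xpredT)) => s _.
by apply: sq_integrableZ; exact: sq_integrable_chi.
Qed.

Lemma sq_momentE (f : Omega -> R) : sq_integrable P f ->
  sq_moment P f = (\int[P]_w (f w * f w))%:E.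
Proof.
move=> fi; rewrite /Rintegral (_ : (\int[P]_w _)%E = sq_moment P f); last first.
  by apply: eq_integral => w _; rewrite expr2.
by rewrite fineK// sq_moment_fin_num.
Qed.

Lemma sq_moment_walsh L c : uniq L -> all (sorted ltn) L ->
  sq_moment P (walsh L c) = (\sum_(s <- L) c s ^+ 2)%:E.
Proof.
move=> uL sL; rewrite sq_momentE; last exact: sq_integrable_walsh.
congr (_%:E); elim: L uL sL => [|s L ih] /=.
  move=> _ _; under eq_Rintegral do rewrite /walsh big_nil mul0r.
  by rewrite Rintegral_prob_cst big_nil.
move=> /andP[sNL uL] /andP[ss sL]; rewrite big_cons -ih//.
have ws := sq_integrable_walsh L c; have cs := sq_integrable_chi s.
have cross : \int[P]_w (chi s w * walsh L c w) = 0.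
  elim: L sNL sL {ih uL ws} => [|t L ih].
    move=> _ _; under eq_Rintegral do rewrite /walsh big_nil mulr0.
    by rewrite Rintegral_prob_cst.
  rewrite in_cons negb_or => /andP[st sNL] /= /andP[stt sL].
  have h1 := sq_integrable_mul cs (sq_integrable_chi t).
  have h2 := sq_integrable_mul cs (sq_integrable_walsh L c).
  have h3 := sq_integrable_mul cs (sq_integrableZ (c t) (sq_integrable_chi t)).
  transitivity (\int[P]_w (chi s w * (c t * chi t w) + chi s w * walsh L c w)).
    by apply: eq_Rintegral => w _; rewrite /walsh big_cons mulrDr.
  rewrite RintegralD// ih// addr0.
  under eq_Rintegral do rewrite mulrCA.
  by rewrite RintegralZl// Rintegral_chi_mul// (negbTE st) mulr0.
have i1 := sq_integrable_mul (sq_integrableZ (c s) cs) (sq_integrableZ (c s) cs).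
have i2 := sq_integrable_mul cs ws.
have i3 := sq_integrable_mul ws ws.
have i4 := sq_integrable_mul (sq_integrableZ (2 * c s) cs) ws.
transitivity (\int[P]_w ((c s * chi s w) * (c s * chi s w) +
  (2 * c s * chi s w * walsh L c w + walsh L c w * walsh L c w))).
  by apply: eq_Rintegral => w _; rewrite /walsh big_cons; ring.
rewrite RintegralD//; last exact: (integrableD _ i4 i3).
rewrite RintegralD//; congr (_ + _).
  under eq_Rintegral do rewrite mulrACA chi_sqr mulr1.
  by rewrite Rintegral_prob_cst expr2.
rewrite -[RHS]add0r; congr (_ + _).
under eq_Rintegral do rewrite -mulrA.
by rewrite RintegralZl// cross mulr0.
Qed.

(** Padding with zero coefficients brings two Walsh sums to a common index list. *)
Lemma walsh_sub L U c : uniq L -> uniq U -> {subset L <= U} ->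
  walsh L c = walsh U (fun s => c s * (s \in L)%:R).
Proof.
move=> uL uU LU; apply/funext => w; rewrite /walsh.
rewrite [RHS](bigID (mem L)) /= [X in _ = _ + X]big1 ?addr0; last first.
  by move=> s /negbTE ->; rewrite mulr0 mul0r.
rewrite -[RHS]big_filter; under [RHS]eq_big_seq => s.
  by rewrite mem_filter => /andP[-> _]; rewrite mulr1; over.
apply: perm_big; apply: uniq_perm => //; first exact: filter_uniq.
by move=> s; rewrite mem_filter; case: (boolP (s \in L)) => // /LU ->.
Qed.

Lemma walshB L c c' :
  walsh L c \- walsh L c' = walsh L (fun s => c s - c' s).
Proof.
apply/funext => w; rewrite /walsh /= -sumrB; apply: eq_bigr => s _.
by rewrite mulrBl.
Qed.

(** A multiplier of Walsh coefficients bounded by K has L^2 norm at most K. It serves for the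
    weights 1/n of L^{-1} and for the truncated divergence. *)
Lemma sq_moment_walshB_le L L' c (b : seq nat -> R) (K : R) : 0 <= K -> uniq L -> uniq L' ->
  all (sorted ltn) L -> all (sorted ltn) L' ->
  (forall s, s \in L ++ L' -> `|b s| <= K) ->
  (sq_moment P (walsh L (fun s => b s * c s)%R \- walsh L' (fun s => b s * c s)%R)%R <=
   (K ^+ 2)%:E * sq_moment P (walsh L c \- walsh L' c)%R)%E.
Proof.
move=> K0 uL uL' sL sL' bK.
pose U := undup (L ++ L').
have uU : uniq U := undup_uniq _.
have LU : {subset L <= U} by move=> s sl; rewrite mem_undup mem_cat sl.
have L'U : {subset L' <= U} by move=> s sl; rewrite mem_undup mem_cat sl orbT.
have sU : all (sorted ltn) U.
  by apply/allP => s; rewrite mem_undup mem_cat => /orP[/(allP sL)|/(allP sL')].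
rewrite !(walsh_sub _ uL uU LU) !(walsh_sub _ uL' uU L'U) !walshB.
rewrite !sq_moment_walsh// -EFinM lee_fin mulr_sumr big_seq [leRHS]big_seq.
apply: ler_sum => s; rewrite mem_undup => /bK bs.
rewrite -(mulrA (b s)) -(mulrA (b s)) -mulrBr exprMn.
rewrite ler_wpM2r ?sqr_ge0//.
by rewrite -[leLHS]real_normK ?num_real// lerXn2r ?nnegrE.
Qed.

(** X_k D_k is diagonal in the Walsh system: it projects onto the functions whose index set contains
    k. Summing over k therefore counts indices. *)
Lemma rad_path_gradient_walsh L c k w : all (sorted ltn) L ->
  rad k w * path_gradient (walsh L c) k w =
  walsh L (fun s => (k \in s)%:R * c s) w.
Proof.
move=> sL; rewrite path_gradient_sum mulr_sumr /walsh big_seq [RHS]big_seq.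
apply: eq_bigr => s /(allP sL) ss.
rewrite path_gradientZ path_gradient_chi ?sorted_ltn_uniq//.
case: ifP => _; last by rewrite !mulr0 mul0r mul0r.
by rewrite mulr1n mul1r mulrCA (mulrA (rad k w)) rad_sqr mul1r.
Qed.

End walsh.

(** * Chaos decompositions *)

Section increasing_sequences.
Implicit Types (s t : seq nat) (q m M k : nat).

(** Plain sequences, unlike tuples, let the index sets of chaoses of different orders live in one
    type. *)
Definition incseqs q M : seq (seq nat) :=
  [seq map val (tval u) | u : q.-tuple 'I_M <- enum {: q.-tuple 'I_M} & sorted ltn (map val (tval u))].

Lemma mem_incseqs q M s : (s \in incseqs q M) =
  [&& size s == q, sorted ltn s & all (fun i => (i < M)%N) s].
Proof.
apply/mapP/and3P => [[t]|[/eqP sq ss sM]].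
  rewrite mem_filter => /andP[st _] ->; split => //.
    by rewrite size_map size_tuple.
  by apply/allP => _ /mapP[i _ ->] /=; exact: ltn_ord.
have : all (fun i => i \in codom (val : 'I_M -> nat)) s.
  apply/allP => i /(allP sM) iM.
  by apply/codomP; exists (Ordinal iM).
move=> sc.
have [u su] : exists u : seq 'I_M, s = map val u.
  elim: s {sq ss sM} sc => [|i s ih] /=; first by exists [::].
  by move=> /andP[/codomP[j ->] /ih[u ->]]; exists (j :: u).
have uq : size u == q by rewrite -sq su size_map.
exists (Tuple uq); last by rewrite su.
by rewrite mem_filter /= mem_enum -su ss.
Qed.

Lemma incseqs_uniq q M : uniq (incseqs q M).
Proof.
rewrite map_inj_uniq; first by rewrite filter_uniq// enum_uniq.
move=> t u /(inj_map val_inj) h; exact: val_inj.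
Qed.

Lemma incseqs_sorted q M : all (sorted ltn) (incseqs q M).
Proof. by apply/allP => s; rewrite mem_incseqs => /and3P[]. Qed.

Lemma incseqs_sub q M M' : (M <= M')%N -> {subset incseqs q M <= incseqs q M'}.
Proof.
move=> MM s; rewrite !mem_incseqs => /and3P[-> -> sM] /=.
by apply: sub_all sM => i iM; exact: leq_trans MM.
Qed.

(** Order 0 is left out because the functionals expanded over this list are centred. *)
Definition chaos_seqs m M : seq (seq nat) :=
  flatten [seq incseqs n M | n <- index_iota 1 m.+1].

Lemma mem_chaos_seqs m M s : (s \in chaos_seqs m M) =
  [&& (0 < size s)%N, (size s <= m)%N, sorted ltn s & all (fun i => (i < M)%N) s].
Proof.
apply/flatten_mapP/and4P => [[n]|[s0 sm ss sM]].
  by rewrite mem_index_iota mem_incseqs => /andP[n0 nm] /and3P[/eqP-> -> ->].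
by exists (size s); rewrite ?mem_index_iota ?s0// mem_incseqs eqxx ss.
Qed.

Lemma chaos_seqs_uniq m M : uniq (chaos_seqs m M).
Proof.
rewrite /chaos_seqs; have := iota_uniq 1 m; rewrite /index_iota subSS subn0.
elim: (iota 1 m) => // n ns ih /= /andP[nns uns].
rewrite cat_uniq incseqs_uniq ih// andbT /=; apply/hasPn => s /flatten_mapP[n' n's].
rewrite !mem_incseqs => /and3P[/eqP sn' _ _]; apply/negP => /and3P[/eqP sn _ _].
by rewrite -sn' sn (negbTE nns) in n's.
Qed.

Lemma chaos_seqs_sorted m M : all (sorted ltn) (chaos_seqs m M).
Proof. by apply/allP => s; rewrite mem_chaos_seqs => /and4P[]. Qed.

(* Removing k is a bijection from the increasing sequences through k onto those
   that avoid k. *)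
Lemma perm_incseqs_rem q M k : (k < M)%N ->
  perm_eq [seq rem k s | s <- incseqs q.+1 M & k \in s]
          [seq t <- incseqs q M | k \notin t].
Proof.
move=> kM; apply: uniq_perm.
- rewrite map_inj_in_uniq ?filter_uniq ?incseqs_uniq// => s t.
  rewrite !mem_filter !mem_incseqs.
  move=> /and4P[ks _ ss _] /and4P[kt _ st _] rst.
  apply: (irr_sorted_eq ltn_trans ltnn ss st) => i.
  by rewrite (perm_mem (perm_to_rem ks)) (perm_mem (perm_to_rem kt)) !in_cons rst.
- by rewrite filter_uniq ?incseqs_uniq.
move=> t; rewrite mem_filter mem_incseqs; apply/mapP/and4P.
  move=> [s]; rewrite mem_filter mem_incseqs => /and4P[ks /eqP sq ss sM] ->.
  have us := sorted_ltn_uniq ss; split.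
  - by rewrite mem_rem_uniq// inE eqxx.
  - by rewrite size_rem// sq.
  - exact: (subseq_sorted ltn_trans (rem_subseq _ _) ss).
  - by apply/allP => i /mem_rem; exact: (allP sM).
move=> [kt /eqP tq st tM].
(* The preimage of t is obtained by inserting k at its sorted place. *)
have pk : perm_eq (sort leq (k :: t)) (k :: t) by rewrite perm_sort.
have us : uniq (sort leq (k :: t)).
  by rewrite sort_uniq /= kt (sorted_ltn_uniq st).
have ss : sorted ltn (sort leq (k :: t)).
  by rewrite ltn_sorted_uniq_leq us (sort_sorted leq_total).
exists (sort leq (k :: t)).
  rewrite mem_filter (perm_mem pk) mem_head mem_incseqs size_sort /= tq eqxx ss.
  apply/allP => i; rewrite (perm_mem pk) in_cons => /predU1P[->//|].
  exact: (allP tM).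
apply: (irr_sorted_eq ltn_trans ltnn st).
  exact: (subseq_sorted ltn_trans (rem_subseq _ _) ss).
move=> i; rewrite mem_rem_uniq// inE (perm_mem pk) in_cons.
by case: eqVneq => // ->; rewrite (negbTE kt).
Qed.

End increasing_sequences.

Section kernels.
Context {R : realType}.
Implicit Types (s : seq nat) (q m M k : nat).

(** The Walsh coefficient of J_q(f) at s, extended by 0 to sequences whose length is not q. *)
Definition kernel_coef q (f : q.-tuple nat -> R) s : R :=
  q`!%:R * oapp f 0 (insub s).

Lemma kernel_coef_tuple q (f : q.-tuple nat -> R) (t : q.-tuple nat) :
  kernel_coef f t = q`!%:R * f t.
Proof. by rewrite /kernel_coef valK. Qed.

Lemma J_uptoE q (f : q.-tuple nat -> R) M :
  J_upto f M = walsh (incseqs q M) (kernel_coef f).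
Proof.
apply/funext => w; rewrite /J_upto /walsh /incseqs big_map big_filter.
rewrite big_enum_cond /= mulr_sumr; apply: eq_big => [t //|t _].
rewrite -[map val t]/(val (map_tuple val t)) kernel_coef_tuple -mulrA /chi.
by rewrite big_map.
Qed.

(* Each strictly increasing sequence of length q has q! rearrangements, on all
   of which a symmetric kernel takes the same value. *)
Lemma kernel_coef_energy q (f : q.-tuple nat -> R) M : is_kernel f ->
  ((\sum_(s <- incseqs q M) kernel_coef f s ^+ 2)%:E <= q`!%:R%:E * sq_norm f)%E.
Proof.
move=> [fsym _ _].
pose f' s := oapp f 0 (insub s : option (q.-tuple nat)).
have f'sym s t : perm_eq s t -> f' s = f' t.
  move=> st; rewrite /f'; case: insubP => [u _ us|].
    by case: insubP => [v _ vt|]; [apply: fsym; rewrite us vt|rewrite -(perm_size st) -us size_tuple eqxx].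
  by case: insubP => // v _ vt; rewrite (perm_size st) -vt size_tuple eqxx.
pose Ls := flatten [seq permutations s | s <- incseqs q M].
have uLs : uniq Ls.
  rewrite /Ls; have := incseqs_uniq q M; have := incseqs_sorted q M.
  elim: (incseqs q M) => // s L ih /= /andP[ss sL] /andP[sNL uL].
  rewrite cat_uniq permutations_uniq ih// andbT /=; apply/hasPn => t /flatten_mapP[u uinL].
  rewrite !mem_permutations => tu; apply: contra sNL => ts.
  suff -> : s = u by [].
  apply: (irr_sorted_eq ltn_trans ltnn ss (allP sL _ uinL)) => i.
  by rewrite -(perm_mem ts) (perm_mem tu).
(* The square of q! f(s) is q! times the sum of f^2 over the q! rearrangements of s. *)
have E : \sum_(s <- incseqs q M) kernel_coef f s ^+ 2 =
    q`!%:R * \sum_(t <- Ls) f' t ^+ 2.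
  rewrite /Ls big_flatten big_map mulr_sumr big_seq [RHS]big_seq.
  apply: eq_bigr => s; rewrite mem_incseqs => /and3P[/eqP sq ss _].
  rewrite (eq_big_seq (fun=> f' s ^+ 2)); last first.
    by move=> t; rewrite mem_permutations => /f'sym ->.
  rewrite big_const_seq count_predT size_permutations ?sorted_ltn_uniq// sq.
  rewrite iter_addr_0 /kernel_coef -/(f' s) -[_ *+ q`!]mulr_natr; ring.
rewrite E EFinM; apply: lee_wpmul2l; first by rewrite lee_fin.
pose Ts : seq (q.-tuple nat) := pmap insub Ls.
have uTs : uniq Ts by exact: pmap_sub_uniq.
rewrite (_ : \sum_(t <- Ls) f' t ^+ 2 = \sum_(t <- Ts) f t ^+ 2); last first.
  rewrite /Ts; elim: (Ls) => [|t L ih] /=; first by rewrite !big_nil.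
  rewrite big_cons ih /f'; case: insubP => [u _ ut|_] /=; first by rewrite big_cons.
  by rewrite expr0n add0r.
apply: esum_ge; exists [set` Ts]; first by split => //; exact: finite_seq.
by rewrite -fsbig_seq// sumEFin.
Qed.

(** D_k maps the Walsh function of s to that of s without k, and (q+1)! = (q+1) q!. The identity is
    exact for the partial sums as soon as coordinate k has entered them. *)
Lemma path_gradient_J_upto q (f : q.+1.-tuple nat -> R) k M w : is_kernel f ->
  (k < M)%N -> path_gradient (J_upto f M) k w =
  q.+1%:R * J_upto (slice f k) M w.
Proof.
move=> [fsym fdiag _] kM; rewrite !J_uptoE path_gradient_sum.
transitivity (\sum_(s <- incseqs q.+1 M | k \in s) kernel_coef f s * chi (rem k s) w).
  rewrite [RHS]big_mkcond big_seq [RHS]big_seq; apply: eq_bigr => s.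
  move=> /(allP (incseqs_sorted _ _))/sorted_ltn_uniq us.
  rewrite path_gradientZ path_gradient_chi//; case: ifP => ks; last by rewrite mulr0.
  congr (_ * _); rewrite {1}/chi (perm_big _ (perm_to_rem ks)) big_cons mulrA rad_sqr.
  by rewrite mul1r.
(* Sequences through k contribute nothing to the slice: appending k repeats an entry, and f vanishes
   there. *)
rewrite /walsh [in RHS](bigID (fun t => k \in t)) /=
  [X in _ * (X + _)]big1_seq ?add0r; last first.
  move=> t /andP[kt]; rewrite mem_incseqs => /andP[tq _].
  rewrite -[t]/(val (Tuple tq)) kernel_coef_tuple /slice fdiag ?mulr0 ?mul0r//.
  by rewrite /= rcons_uniq kt.
rewrite -[\sum_(i <- _ | _ \notin _) _]big_filter -(perm_big _ (perm_incseqs_rem q kM)).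
rewrite /= big_map big_filter mulr_sumr big_seq_cond [RHS]big_seq_cond.
apply: eq_bigr => s /andP[+ ks]; rewrite mem_incseqs => /and3P[sq ss _].
rewrite mulrA; congr (_ * _).
have rq : size (rem k s) == q by rewrite size_rem// (eqP sq).
rewrite -[s in LHS]/(val (Tuple sq)) -[rem k s]/(val (Tuple rq)) !kernel_coef_tuple.
rewrite mulrA -natrM -factS; congr (_ * _); apply: fsym => /=.
by rewrite perm_sym perm_rcons perm_sym perm_to_rem.
Qed.

End kernels.

Section mean_square_limits.
Context {R : realType} (P : probability Omega R).
Implicit Types (u v : nat -> Omega -> R) (Y Z : Omega -> R).

Lemma eq_sq_cvg u v Y Z : (forall n, u n =1 v n) -> Y =1 Z ->
  sq_cvg P u Y -> sq_cvg P v Z.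
Proof.
move=> uv YZ; rewrite (_ : u = v); last by apply/funext => n; exact/funext/uv.
by rewrite (_ : Y = Z)//; exact/funext.
Qed.

Lemma L2_cvgP u Y : L2_cvg P u Y <->
  [/\ forall n, sq_integrable P (u n), sq_integrable P Y & sq_cvg P u Y].
Proof.
split=> [[ui Yi uY]|[ui Yi uY]].
  have ui' n : sq_integrable P (u n) by apply/Lfun2P; exact: ui.
  have Yi' : sq_integrable P Y by apply/Lfun2P.
  by split => //; apply/(sq_cvgP ui' Yi').
by split; [move=> n; apply/Lfun2P; exact: ui|exact/Lfun2P|exact/sq_cvgP].
Qed.

Lemma L2_lim_cvg u Y : L2_cvg P u Y -> L2_cvg P u (L2_lim P u).
Proof. by move=> uY; rewrite /L2_lim; case: xgetP => // /(_ Y). Qed.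

Lemma sq_integrable_L2_lim u : sq_integrable P (L2_lim P u).
Proof.
rewrite /L2_lim; case: xgetP => [Z _ /L2_cvgP[]//|_].
exact: sq_integrable_cst.
Qed.

Lemma L2_lim_ae u Y : (forall n, sq_integrable P (u n)) -> sq_integrable P Y ->
  sq_cvg P u Y -> {ae P, forall w, L2_lim P u w = Y w}.
Proof.
move=> ui Yi uY.
have uY2 : L2_cvg P u Y by apply/L2_cvgP.
have /L2_cvgP[_ Li uL] := L2_lim_cvg uY2.
apply: (sq_cvg_unique _ _ _ uL uY); [|by case: Li|by case: Yi].
by move=> n; case: (ui n).
Qed.

Lemma sq_cvg_Rintegral u Y : (forall n, sq_integrable P (u n)) ->
  sq_integrable P Y -> sq_cvg P u Y ->
  (forall n, \int[P]_w u n w = 0) -> \int[P]_w Y w = 0.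
Proof.
move=> ui Yi uY u0; apply/normr0_eq0/eqP; rewrite eq_le normr_ge0 andbT.
apply/ler_addgt0Pl => e e0; rewrite addr0.
have e2 : 0 < e / 2 by rewrite divr_gt0.
have [n0 /(_ n0 (leqnn _)) hn] := uY _ (exprn_gt0 2 e2).
have dYi := sq_integrableB (ui n0) Yi.
have -> : \int[P]_w Y w = - \int[P]_w (u n0 w - Y w).
  rewrite RintegralB//; [|exact: sq_integrable_integrable..].
  by rewrite u0 sub0r opprK.
rewrite normrN.
have /le_trans -> // := le_normr_Rintegral measurableT (sq_integrable_integrable dYi).
rewrite /Rintegral -lee_fin fineK; last first.
  apply: integrable_fin_num => //.
  exact: (integrable_norm (sq_integrable_integrable dYi)).
apply: le_trans (abs_integral_le P e2 dYi.1) _.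
apply: le_trans (leeD (lexx _) (lee_wpmul2l _ hn)) _.
  by rewrite lee_fin invr_ge0 ltW.
by rewrite -EFinM -EFinD lee_fin expr2 mulKf ?gt_eqF//; lra.
Qed.

End mean_square_limits.

(** * Convergence of multiple integrals and the gradient on chaoses *)

Section multiple_integrals.
Context {R : realType} (P : probability Omega R).
Context (hP : is_rademacher_measure P).

(** By orthonormality, the squared distance of two partial sums is the difference of their sums of
    squared coefficients, which are monotone and bounded. *)
Lemma walsh_increasing_cvg (L : nat -> seq (seq nat)) (c : seq nat -> R) (B : R) :
  (forall n, uniq (L n)) -> (forall n, all (sorted ltn) (L n)) ->
  (forall m n, (m <= n)%N -> {subset L m <= L n}) ->
  (forall n, \sum_(s <- L n) c s ^+ 2 <= B) ->
  exists2 Y, sq_integrable P Y & sq_cvg P (fun n => walsh (L n) c) Y.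
Proof.
move=> uL sL LL cB; pose a n := \sum_(s <- L n) c s ^+ 2.
have dE m n : (m <= n)%N ->
    sq_moment P (walsh (L n) c \- walsh (L m) c) = (a n - a m)%:E.
  move=> mn; rewrite (walsh_sub c (uL m) (uL n) (LL _ _ mn)) walshB sq_moment_walsh//.
  congr (_%:E); apply/eqP; rewrite eq_sym subr_eq; apply/eqP.
  rewrite {2}/a (_ : \sum_(s <- L m) c s ^+ 2 =
      \sum_(s <- L n) (c s * (s \in L m)%:R) ^+ 2); last first.
    apply: EFin_inj; rewrite -!(sq_moment_walsh hP)//.
    by rewrite -walsh_sub//; exact: LL.
  rewrite -big_split; apply: eq_bigr => s _ /=.
  by case: (s \in L m); rewrite ?mulr1 ?mulr0; ring.
have and_ : {homo a : m n / (m <= n)%N >-> m <= n}.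
  by move=> m n mn; rewrite -subr_ge0 -lee_fin -dE// sq_moment_ge0.
have ac : cvgn a.
  by apply: nondecreasing_is_cvgn => //; exists B => _ [n _ <-]; exact: cB.
apply: sq_complete => [n|e e0]; first exact: sq_integrable_walsh.
have /cvgrPdist_le/(_ _ e0)[n0 _ hn0] := ac.
have key m n : (n0 <= m)%N -> (m <= n)%N ->
    (sq_moment P (walsh (L n) c \- walsh (L m) c)%R <= e%:E)%E.
  move=> nm mn; rewrite dE// lee_fin.
  have := hn0 _ nm; rewrite ler_norml => /andP[_].
  have : a n <= limn a by exact: nondecreasing_cvgn_le.
  lra.
exists n0 => m n n0m n0n; have [mn|/ltnW nm] := leqP m n.
  rewrite (_ : (_ \- _) = fun w => - (walsh (L n) c \- walsh (L m) c) w).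
    by rewrite sq_momentN key.
  by apply/funext => w /=; rewrite opprB.
exact: key.
Qed.

Lemma sq_integrable_J_upto q (f : q.-tuple nat -> R) M : sq_integrable P (J_upto f M).
Proof. by rewrite J_uptoE; exact: sq_integrable_walsh. Qed.

(** On kernels, [J] is thus a genuine limit and not the default value of [L2_lim]. *)
Lemma J_cvg q (f : q.-tuple nat -> R) : is_kernel f ->
  sq_cvg P (J_upto f) (J P f).
Proof.
move=> fk.
suff : exists Y, L2_cvg P (J_upto f) Y by move=> [Y /L2_lim_cvg/L2_cvgP[]].
have qf_fin : (q`!%:R%:E * sq_norm f)%E \is a fin_num.
  have [_ _ fi] := fk; rewrite ge0_fin_numE ?lte_mul_pinfty ?lee_fin//.
  by rewrite mule_ge0 ?lee_fin//; apply: esum_ge0 => t _; rewrite lee_fin sqr_ge0.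
have [||||Y Yi uY] := @walsh_increasing_cvg (incseqs q) (kernel_coef f)
   (fine (q`!%:R%:E * sq_norm f)%E).
- exact: incseqs_uniq.
- exact: incseqs_sorted.
- exact: incseqs_sub.
- by move=> M; rewrite -lee_fin fineK//; exact: kernel_coef_energy.
exists Y; apply/L2_cvgP; split => // [M|]; first exact: sq_integrable_J_upto.
by apply: eq_sq_cvg uY => // M w; rewrite J_uptoE.
Qed.

Lemma sq_integrable_J q (f : q.-tuple nat -> R) : sq_integrable P (J P f).
Proof. exact: sq_integrable_L2_lim. Qed.

Lemma Rintegral_walsh_eq0 (L : seq (seq nat)) (c : seq nat -> R) :
  all (sorted ltn) L -> [::] \notin L -> \int[P]_w walsh L c w = 0.
Proof.
elim: L => [|s L ih] /=.
  by move=> _ _; under eq_Rintegral do rewrite /walsh big_nil; rewrite Rintegral_prob_cst.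
move=> /andP[ss sL]; rewrite in_cons negb_or => /andP[s0 L0].
have h1 := sq_integrableZ (c s) (sq_integrable_chi P s).
transitivity (\int[P]_w (c s * chi s w + walsh L c w)).
  by apply: eq_Rintegral => w _; rewrite /walsh big_cons.
rewrite RintegralD//; last 2 first.
  exact: sq_integrable_integrable h1.
  exact: sq_integrable_integrable (sq_integrable_walsh P L c).
rewrite ih// addr0 RintegralZl//; last exact: sq_integrable_integrable (sq_integrable_chi P s).
have := Rintegral_chi_mul hP ss (isT : sorted ltn [::]).
under eq_Rintegral do rewrite [chi [::] _]/chi big_nil mulr1.
by rewrite eq_sym (negbTE s0) => ->; rewrite mulr0.
Qed.

Lemma Rintegral_J q (f : q.+1.-tuple nat -> R) : is_kernel f ->
  \int[P]_w J P f w = 0.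
Proof.
move=> fk; apply: (sq_cvg_Rintegral (sq_integrable_J_upto f) (sq_integrable_J f) (J_cvg fk)).
move=> M; rewrite J_uptoE Rintegral_walsh_eq0 ?incseqs_sorted//.
by rewrite mem_incseqs.
Qed.

(** The partial sums for the slice converge because, up to the factor q + 1, they are eventually the
    gradients of those for f, and D_k is continuous in mean square. *)
Lemma J_path_gradient q (f : q.+1.-tuple nat -> R) k : is_kernel f ->
  {ae P, forall w, path_gradient (J P f) k w = q.+1%:R * J P (slice f k) w}.
Proof.
move=> fk.
have q0 : (q.+1%:R : R) != 0 by rewrite pnatr_eq0.
have c1 := sq_cvg_path_gradient hP k (sq_integrable_J_upto f) (sq_integrable_J f) (J_cvg fk).
have gi := sq_integrable_path_gradient hP k (sq_integrable_J f).
have c2 : sq_cvg P (J_upto (slice f k)) (fun w => q.+1%:R^-1 * path_gradient (J P f) k w).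
  have ei M := sq_integrable_path_gradient hP k (sq_integrable_J_upto f M).
  have := sq_cvgZ q.+1%:R^-1 ei gi c1.
  apply: sq_cvg_ext.
  - by move=> M; case: (sq_integrableZ q.+1%:R^-1 (ei M)).
  - by case: (sq_integrableZ q.+1%:R^-1 gi).
  - by move=> M; case: (sq_integrable_J_upto (slice f k) M).
  - by case: (sq_integrableZ q.+1%:R^-1 gi).
  - exists k.+1 => M kM; apply: aeW => w; rewrite path_gradient_J_upto//.
    by rewrite mulKf.
  - exact: aeW.
have := L2_lim_ae (sq_integrable_J_upto (slice f k)) (sq_integrableZ _ gi) c2.
by apply: filterS => w; rewrite -/(J P (slice f k) w) => ->; rewrite mulVKf.
Qed.

Lemma chaos_kernelsP (F : Omega -> R) (f : kernels) : chaos_decomposition P F f ->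
  chaos_decomposition P F (chaos_kernels P F).
Proof. by move=> Ff; rewrite /chaos_kernels; case: xgetP => // /(_ f). Qed.

(** For a single k, the series defining D_k F converges by continuity of D_k in mean square;
    membership in [dom_D] concerns the sum over all k. *)
Lemma D_path_gradient (F : Omega -> R) (f : kernels) k : chaos_decomposition P F f ->
  {ae P, forall w, D P F k w = path_gradient F k w}.
Proof.
move=> /chaos_kernelsP; set g := chaos_kernels P F => -[_ gk /L2_cvgP[ui Fi uF]].
have Fgi := sq_integrable_path_gradient hP k Fi.
have vi m : sq_integrable P
    (fun w => \sum_(n < m) n.+1%:R * J P (slice (g n.+1) k) w).
  apply: (sq_integrable_sum _ (p := xpredT)) => n _.
  by apply: sq_integrableZ; exact: sq_integrable_J.
apply: (L2_lim_ae vi Fgi).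
have := sq_cvg_path_gradient hP k ui Fi uF; apply: sq_cvg_ext.
- by move=> m; case: (sq_integrable_path_gradient hP k (ui m)).
- by case: Fgi.
- by move=> m; case: (vi m).
- by case: Fgi.
- exists 0%N => m _.
  have := ae_foralln (fun n => J_path_gradient k (gk n.+1)).
  apply: filterS => w h.
  (* The gradient does not see the constant E[F]. *)
  rewrite (_ : path_gradient _ k w =
     path_gradient (fun w => \sum_(1 <= n < m.+1) J P (g n) w) k w); last first.
    by rewrite /path_gradient; congr (_ / _); ring.
  rewrite path_gradient_sum big_add1 /= big_mkord.
  by apply: eq_bigr => n _; exact: h.
- exact: aeW.
Qed.

End multiple_integrals.

(** * The operator L^{-1}, gradient energies and the divergence *)

Section inverse_generator.
Context {R : realType} (P : probability Omega R).
Context (hP : is_rademacher_measure P).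

(** The factor 4 is the cost of two uses of the quadratic substitute for the triangle inequality. *)
Lemma sq_cvg_moment_le (u v : nat -> Omega -> R) (U V : Omega -> R) :
  (forall n, sq_integrable P (u n)) -> sq_integrable P U ->
  (forall n, sq_integrable P (v n)) -> sq_integrable P V ->
  sq_cvg P u U -> sq_cvg P v V ->
  (forall n, sq_moment P (u n) <= sq_moment P (v n))%E ->
  (sq_moment P U <= 4%:E * sq_moment P V)%E.
Proof.
move=> ui Ui vi Vi uU vV uv; apply/lee_addgt0Pr => e e0.
have e6 : 0 < e / 6 by rewrite divr_gt0.
have [n0 h0] := uU _ e6; have [n1 h1] := vV _ e6.
set n := maxn n0 n1.
have {}h0 := h0 n (leq_maxl _ _); have {}h1 := h1 n (leq_maxr _ _).
have VE := fineK (sq_moment_fin_num Vi); set a := fine _ in VE.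
have vn : (sq_moment P (v n) <= (2 * (e / 6) + 2 * a)%:E)%E.
  have -> : v n = (v n \- V) \+ V by apply/funext => w /=; rewrite subrK.
  apply: sq_momentD_le => //; [|by case: Vi|by rewrite VE].
  by case: (sq_integrableB (vi n) Vi).
have -> : U = u n \- (u n \- U) by apply/funext => w /=; ring.
apply: le_trans (sq_momentB_le _ _ (le_trans (uv n) vn) h0) _.
- by case: (ui n).
- by case: (sq_integrableB (ui n) Ui).
- by rewrite -VE -EFinM -EFinD lee_fin; lra.
Qed.

Definition chaos_coef (g : kernels) (s : seq nat) : R := kernel_coef (g (size s)) s.

(** The weight 1 gives the partial sums of a centred F, the weight 1/n those of -L^{-1} F. *)
Definition chaos_sum (g : kernels) (beta : nat -> R) (m : nat) (w : Omega) : R :=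
  \sum_(1 <= n < m.+1) beta n * J P (g n) w.

Definition chaos_coef_weighted (g : kernels) (beta : nat -> R) (s : seq nat) : R := beta (size s) * chaos_coef g s.

Definition chaos_approx (g : kernels) (beta : nat -> R) (m M : nat) : Omega -> R :=
  walsh (chaos_seqs m M) (chaos_coef_weighted g beta).

Lemma sq_integrable_chaos_sum g beta m : sq_integrable P (chaos_sum g beta m).
Proof.
apply: (sq_integrable_sum _ (p := xpredT)) => n _.
by apply: sq_integrableZ; exact: sq_integrable_J.
Qed.

Lemma chaos_approx_cvg (g : kernels) beta m : (forall n, is_kernel (g n)) ->
  sq_cvg P (chaos_approx g beta m) (chaos_sum g beta m).
Proof.
move=> gk.
have : sq_cvg P (fun M w => \sum_(n <- index_iota 1 m.+1) beta n * J_upto (g n) M w)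
    (chaos_sum g beta m).
  apply: sq_cvg_sum => [n M|n|n].
  - by apply: sq_integrableZ; exact: sq_integrable_J_upto.
  - by apply: sq_integrableZ; exact: sq_integrable_J.
  - apply: sq_cvgZ; [|exact: sq_integrable_J|exact: J_cvg].
    by move=> M; exact: sq_integrable_J_upto.
apply: eq_sq_cvg => // M w.
rewrite /chaos_approx /walsh /chaos_seqs big_flatten big_map.
apply: eq_bigr => n _; rewrite J_uptoE /walsh mulr_sumr big_seq [RHS]big_seq.
apply: eq_bigr => s; rewrite mem_incseqs => /and3P[/eqP sn _ _].
by rewrite /chaos_coef_weighted /chaos_coef sn mulrA.
Qed.

Lemma chaos_sum1 (g : kernels) m w :
  chaos_sum g (fun=> 1) m w = \sum_(1 <= n < m.+1) J P (g n) w.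
Proof. by apply: eq_bigr => n _; rewrite mul1r. Qed.

(** For finite Walsh sums this is the multiplier bound with K = 1; the factor 4 appears in the limit
    M to infinity. *)
Lemma chaos_sum_moment_le (g : kernels) (beta : nat -> R) m m' :
  (forall n, is_kernel (g n)) -> (forall n, `|beta n| <= 1) ->
  (sq_moment P (chaos_sum g beta m \- chaos_sum g beta m')%R <=
   4%:E * sq_moment P (chaos_sum g (fun=> 1) m \- chaos_sum g (fun=> 1) m')%R)%E.
Proof.
move=> gk beta1.
have dcvg (b : nat -> R) : sq_cvg P (fun M => chaos_approx g b m M \- chaos_approx g b m' M)
    (chaos_sum g b m \- chaos_sum g b m').
  have h2 := sq_cvgZ (-1) (fun M => sq_integrable_walsh P _ _)
    (sq_integrable_chaos_sum g b m') (chaos_approx_cvg b m' gk).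
  have := sq_cvgD _ _ _ _ (chaos_approx_cvg b m gk) h2.
  rewrite (_ : (fun n : nat => _) = fun M => chaos_approx g b m M \- chaos_approx g b m' M); last first.
    by apply/funext => M; apply/funext => w /=; rewrite mulN1r.
  rewrite (_ : chaos_sum g b m \+ _ = chaos_sum g b m \- chaos_sum g b m'); last first.
    by apply/funext => w /=; rewrite mulN1r.
  apply.
  - by move=> M; case: (sq_integrable_walsh P (chaos_seqs m M) (chaos_coef_weighted g b)).
  - by case: (sq_integrable_chaos_sum g b m).
  - by move=> M; case: (sq_integrableZ (-1) (sq_integrable_walsh P (chaos_seqs m' M) (chaos_coef_weighted g b))).
  - by case: (sq_integrableZ (-1) (sq_integrable_chaos_sum g b m')).
apply: (sq_cvg_moment_le _ _ _ _ (dcvg beta) (dcvg (fun=> 1))).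
- by move=> M; apply: sq_integrableB; exact: sq_integrable_walsh.
- by apply: sq_integrableB; exact: sq_integrable_chaos_sum.
- by move=> M; apply: sq_integrableB; exact: sq_integrable_walsh.
- by apply: sq_integrableB; exact: sq_integrable_chaos_sum.
move=> M; have := @sq_moment_walshB_le R P hP (chaos_seqs m M) (chaos_seqs m' M)
  (chaos_coef_weighted g (fun=> 1)) (beta \o size) 1 ler01 (chaos_seqs_uniq _ _)
  (chaos_seqs_uniq _ _) (chaos_seqs_sorted _ _) (chaos_seqs_sorted _ _)
  (fun s _ => beta1 (size s)).
rewrite expr1n mul1e; apply: le_trans.
rewrite /chaos_approx (_ : chaos_coef_weighted g beta =
  fun s => (beta \o size) s * chaos_coef_weighted g (fun=> 1) s)//.
by apply/funext => s; rewrite /chaos_coef_weighted mul1r.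
Qed.

Context (F : Omega -> R) (f : @kernels R).
Context (Ff : chaos_decomposition P F f).
Context (F0 : ('E_P[F] = 0)%E).

Local Notation g := (chaos_kernels P F : forall n, n.-tuple nat -> R).
Local Notation inv_weight := (fun n : nat => (n%:R^-1 : R)).

Let gk n : is_kernel (g n). Proof. by have [_ /(_ n)] := chaos_kernelsP Ff. Qed.

Lemma chaos_decomposition_cvg (h : kernels) : chaos_decomposition P F h ->
  sq_cvg P (chaos_sum h (fun=> 1)) F.
Proof.
move=> [_ _ /L2_cvgP[_ _]]; rewrite F0 /=.
by apply: eq_sq_cvg => // m w; rewrite add0r chaos_sum1.
Qed.

Lemma sq_integrable_chaos : sq_integrable P F.
Proof. by have [/Lfun2P] := Ff. Qed.

Lemma norm_inv_nat_le1 n : `|inv_weight n| <= 1.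
Proof.
rewrite ger0_norm ?invr_ge0//; case: n => [|n]; first by rewrite invr0.
by rewrite invf_le1 ?ler1n// ltr0n.
Qed.

(** The weighted partial sums are Cauchy by comparison with those of F, so the limit defining [Linv]
    exists. The sign is moved to keep the weights positive. *)
Lemma Linv_cvg : sq_integrable P (Linv P F) /\
  sq_cvg P (chaos_sum g inv_weight) (fun w => - Linv P F w).
Proof.
have [e e0|Y Yi uY] := @sq_complete _ _ _ P (chaos_sum g inv_weight)
    (sq_integrable_chaos_sum g inv_weight).
  (* The comparison costs a factor 4 and the passage through F another 2 + 2. *)
  have e16 : 0 < e / 16 by rewrite divr_gt0.
  have [n0 hn] := chaos_decomposition_cvg (chaos_kernelsP Ff) e16.
  exists n0 => m n /hn hm /hn {}hn.
  apply: le_trans (chaos_sum_moment_le m n gk norm_inv_nat_le1) _.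
  rewrite (_ : _ \- _ = (chaos_sum g (fun=> 1) m \- F) \- (chaos_sum g (fun=> 1) n \- F)); last first.
    by apply/funext => w /=; ring.
  apply: le_trans (lee_wpmul2l _ (sq_momentB_le _ _ hm hn)) _ => //.
  - by case: (sq_integrableB (sq_integrable_chaos_sum g (fun=> 1) m) sq_integrable_chaos).
  - by case: (sq_integrableB (sq_integrable_chaos_sum g (fun=> 1) n) sq_integrable_chaos).
  - by rewrite -EFinM lee_fin; lra.
have Li : sq_integrable P (Linv P F) by exact: sq_integrable_L2_lim.
split => //.
have ui m : sq_integrable P (fun w => - \sum_(1 <= n < m.+1) n%:R^-1 * J P (g n) w).
  exact: sq_integrableN (sq_integrable_chaos_sum g inv_weight m).
have uY' : sq_cvg P (fun m w => - \sum_(1 <= n < m.+1) n%:R^-1 * J P (g n) w)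
    (fun w => - Y w).
  have := sq_cvgZ (-1) (sq_integrable_chaos_sum g inv_weight) Yi uY.
  by apply: eq_sq_cvg => [m w|w]; rewrite mulN1r.
have := L2_lim_ae ui (sq_integrableN Yi) uY'; rewrite -/(Linv P F) => LY.
apply: sq_cvg_ext uY.
- by move=> m; case: (sq_integrable_chaos_sum g inv_weight m).
- by case: Yi.
- by move=> m; case: (sq_integrable_chaos_sum g inv_weight m).
- by case: (sq_integrableN Li).
- by exists 0%N => m _; exact: aeW.
- by apply: filterS LY => w ->; rewrite opprK.
Qed.

Lemma sq_norm_scale q (h : q.-tuple nat -> R) (a : R) :
  (sq_norm h < +oo)%E -> (sq_norm (fun t => a * h t)%R < +oo)%E.
Proof.
move=> hi; have h0 : (0 <= sq_norm h)%E by apply: esum_ge0 => t _; rewrite lee_fin sqr_ge0.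
apply: (@le_lt_trans _ _ ((a ^+ 2)%:E * sq_norm h)%E); last first.
  by rewrite lte_mul_pinfty ?lee_fin ?sqr_ge0// ge0_fin_numE.
apply: ge_ereal_sup => _ [X [fX _] <-].
under eq_fsbigr do rewrite exprMn EFinM.
rewrite -ge0_mule_fsumr; last by move=> t; rewrite lee_fin sqr_ge0.
apply: lee_wpmul2l; first by rewrite lee_fin sqr_ge0.
by apply: esum_ge; exists X.
Qed.

Lemma kernel_scale q (h : q.-tuple nat -> R) (a : R) :
  is_kernel h -> is_kernel (fun t => a * h t).
Proof.
move=> [hs hd hi]; split => [s t st|t tu|]; last exact: sq_norm_scale.
  by rewrite (hs _ _ st).
by rewrite hd// mulr0.
Qed.

Lemma J_scale q (h : q.-tuple nat -> R) (a : R) : is_kernel h ->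
  {ae P, forall w, J P (fun t => a * h t) w = a * J P h w}.
Proof.
move=> hk; apply: (L2_lim_ae (sq_integrable_J_upto P _)).
  by apply: sq_integrableZ; exact: sq_integrable_J.
apply: eq_sq_cvg (sq_cvgZ a (sq_integrable_J_upto P h) (sq_integrable_J P h) (J_cvg hP hk)).
  move=> M w; rewrite /J_upto mulrCA; congr (_ * _); rewrite mulr_sumr.
  by apply: eq_bigr => t _; rewrite mulrA.
by [].
Qed.

(** [D P (Linv P F)] is built from kernels chosen for [Linv P F]; exhibiting one decomposition makes
    that choice meaningful and gives access to [D_path_gradient]. *)
Lemma Linv_chaos_decomposition :
  chaos_decomposition P (Linv P F) (fun n t => - n%:R^-1 * g n t).
Proof.
have [Li Lc] := Linv_cvg.
have E0 : ('E_P[Linv P F] = 0)%E.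
  rewrite unlock -[LHS]fineK; last exact: integrable_fin_num (sq_integrable_integrable Li).
  rewrite -/(Rintegral _ _ _).
  suff : \int[P]_w (- Linv P F w) = 0.
    under eq_Rintegral do rewrite -mulN1r.
    rewrite RintegralZl//; last exact: (sq_integrable_integrable Li).
    by rewrite mulN1r => /eqP; rewrite oppr_eq0 => /eqP ->.
  apply: (sq_cvg_Rintegral (sq_integrable_chaos_sum g inv_weight) (sq_integrableN Li) Lc).
  move=> m; rewrite /chaos_sum; elim: m => [|m ih].
    by under eq_Rintegral do rewrite big_nil; rewrite Rintegral_prob_cst.
  under eq_Rintegral do rewrite big_nat_recr//=.
  rewrite RintegralD//; last 2 first.
    exact: sq_integrable_integrable (sq_integrable_chaos_sum g inv_weight m).
    exact: sq_integrable_integrable (sq_integrableZ _ (sq_integrable_J P _)).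
  rewrite ih RintegralZl//; last exact: sq_integrable_integrable (sq_integrable_J P _).
  by rewrite Rintegral_J// mulr0 addr0.
split; [exact/Lfun2P|by move=> n; exact: kernel_scale|].
have ui m : sq_integrable P (fun w => fine 'E_P[Linv P F] +
    \sum_(1 <= n < m.+1) J P (fun t => - n%:R^-1 * g n t) w).
  apply: sq_integrableD; first exact: sq_integrable_cst.
  by apply: (sq_integrable_sum _ (p := xpredT)) => n _; exact: sq_integrable_J.
apply/L2_cvgP; split => //.
have := sq_cvgZ (-1) (sq_integrable_chaos_sum g inv_weight) (sq_integrableN Li) Lc.
apply: sq_cvg_ext.
- by move=> m; case: (sq_integrableZ (-1) (sq_integrable_chaos_sum g inv_weight m)).
- by case: (sq_integrableZ (-1) (sq_integrableN Li)).
- by move=> m; case: (ui m).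
- by case: Li.
- exists 0%N => m _; apply: filterS (ae_foralln (fun n => J_scale (- n%:R^-1) (gk n))) => w h.
  rewrite E0 /= add0r mulN1r -sumrN; apply: eq_bigr => n _.
  by rewrite h mulNr.
- by apply: aeW => w; rewrite mulN1r opprK.
Qed.

Lemma chaos_approx_exists (h : kernels) (b : nat -> R) (G : Omega -> R) (e : R) :
  (forall n, is_kernel (h n)) -> sq_integrable P G ->
  sq_cvg P (chaos_sum h b) G -> 0 < e ->
  exists m0, forall m, (m0 <= m)%N -> exists M0, forall M, (M0 <= M)%N ->
    (sq_moment P (G \- chaos_approx h b m M)%R <= e%:E)%E.
Proof.
move=> hk Gi hG e0; have e4 : 0 < e / 4 by rewrite divr_gt0.
have [m0 hm] := hG _ e4; exists m0 => m /hm {}hm.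
have [M0 hM] := chaos_approx_cvg b m hk e4; exists M0 => M /hM {}hM.
have Si := sq_integrable_chaos_sum h b m.
have Ai := sq_integrable_walsh P (chaos_seqs m M) (chaos_coef_weighted h b).
rewrite (_ : _ \- _ = (fun w => - ((chaos_approx h b m M \- chaos_sum h b m) \+
  (chaos_sum h b m \- G)) w)); last by apply/funext => w /=; ring.
rewrite sq_momentN; apply: le_trans (sq_momentD_le _ _ hM hm) _.
- by case: (sq_integrableB Ai Si).
- by case: (sq_integrableB Si Gi).
- by rewrite lee_fin; lra.
Qed.

Lemma sum_mem_count (s : seq nat) K : uniq s ->
  (\sum_(k < K) (val k \in s : nat))%N = count (fun i => (i < K)%N) s.
Proof.
rewrite -(big_mkord xpredT (fun k => (k \in s : nat))).
elim: s => [_|i s ih] /=; first by rewrite big1.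
move=> /andP[si us]; rewrite (eq_bigr (fun k => (k == i) + (k \in s))%N); last first.
  move=> k _; rewrite in_cons; case: eqVneq => //= ->.
  by rewrite (negbTE si).
rewrite big_split /= ih//; congr (_ + _)%N.
have [iK|Ki] := ltnP i K.
  rewrite (bigD1_seq i) ?mem_index_iota ?iota_uniq//= eqxx big1 ?addn0// => k.
  by move=> /negbTE ->.
rewrite big1_seq// => k /andP[_]; rewrite mem_index_iota => /andP[_ kK].
by case: eqVneq => // ki; move: kK; rewrite ki ltnNge Ki.
Qed.

(** For a Walsh sum, the energy over all k is the sum of |s| c_s^2. Each D_k is a contraction, so an
    approximation error of 1/(K+1) adds at most 1 over K coordinates; B must not depend on e. *)
Lemma gradient_energy_le (G : Omega -> R) (B : R) : sq_integrable P G ->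
  (forall e : R, 0 < e -> exists L c, [/\ uniq L, all (sorted ltn) L,
     (sq_moment P (G \- walsh L c)%R <= e%:E)%E &
     \sum_(s <- L) (size s)%:R * c s ^+ 2 <= B]) ->
  forall K, (\sum_(k < K) sq_moment P (path_gradient G k) <= (2 + 2 * B)%:E)%E.
Proof.
move=> Gi hG K; have K0 : 0 < K.+1%:R^-1 :> R by rewrite invr_gt0 ltr0n.
have [L [c [uL sL GL cB]]] := hG _ K0.
have Wi := sq_integrable_walsh P L c.
have kE (k : nat) : (sq_moment P (path_gradient G k) <=
    (2 * K.+1%:R^-1 + 2 * \sum_(s <- L) (k \in s)%:R * c s ^+ 2)%:E)%E.
  rewrite (_ : path_gradient G k =
    path_gradient (G \- walsh L c) k \+ path_gradient (walsh L c) k); last first.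
    by rewrite path_gradientB; apply/funext => w /=; rewrite subrK.
  have GWi := sq_integrableB Gi Wi.
  apply: sq_momentD_le.
  - by case: (sq_integrable_path_gradient hP k GWi).
  - by case: (sq_integrable_path_gradient hP k Wi).
  - by apply: le_trans GL; apply: sq_moment_path_gradient => //; case: GWi.
  - rewrite -(sq_moment_rad P k) (_ : (fun w => _) = walsh L (fun s => (k \in s)%:R * c s)).
      rewrite sq_moment_walsh// lee_fin; apply: ler_sum => s _.
      by case: (k \in s); rewrite ?mul1r ?mul0r// expr0n.
    by apply/funext => w; rewrite rad_path_gradient_walsh.
apply: le_trans (lee_sum _ (fun k _ => kE (val k))) _.
rewrite sumEFin lee_fin big_split /= sumr_const card_ord lerD//.
  by rewrite -[_ *+ K]mulr_natr mulrAC ler_pdivrMr ?ltr0n// ler_pM2l// ler_nat.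
rewrite -mulr_sumr ler_pM2l// exchange_big /=.
apply: le_trans cB; rewrite big_seq [leRHS]big_seq; apply: ler_sum => s sL'.
rewrite -mulr_suml ler_wpM2r ?sqr_ge0// -natr_sum ler_nat.
have us : uniq s by apply: sorted_ltn_uniq; exact: (allP sL).
by rewrite sum_mem_count// count_size.
Qed.

Lemma chaos_energyE (h : kernels) m M :
  \sum_(s <- chaos_seqs m M) (size s)%:R * chaos_coef_weighted h (fun=> 1) s ^+ 2 =
  \sum_(1 <= n < m.+1) n%:R * \sum_(s <- incseqs n M) kernel_coef (h n) s ^+ 2.
Proof.
rewrite /chaos_seqs big_flatten big_map; apply: eq_bigr => n _.
rewrite mulr_sumr big_seq [RHS]big_seq; apply: eq_bigr => s.
rewrite mem_incseqs => /and3P[/eqP sn _ _].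
by rewrite /chaos_coef_weighted /chaos_coef sn mul1r.
Qed.

(** Using the same truncation for F and -L^{-1} F makes their Walsh coefficients differ exactly by
    the factor 1/|s|. *)
Lemma chaos_approx_joint e : 0 < e ->
  exists m M, (sq_moment P (F \- chaos_approx g (fun=> 1) m M)%R <= e%:E)%E /\
    (sq_moment P ((fun w => - Linv P F w) \- chaos_approx g inv_weight m M)%R <= e%:E)%E.
Proof.
move=> e0; have [Li Lc] := Linv_cvg.
have [m0 h0] := chaos_approx_exists gk sq_integrable_chaos
  (chaos_decomposition_cvg (chaos_kernelsP Ff)) e0.
have [m1 h1] := chaos_approx_exists gk (sq_integrableN Li) Lc e0.
have [M0 {}h0] := h0 _ (leq_maxl m0 m1).
have [M1 {}h1] := h1 _ (leq_maxr m0 m1).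
exists (maxn m0 m1), (maxn M0 M1); split; first exact: h0 (leq_maxl _ _).
exact: h1 (leq_maxr _ _).
Qed.

(** Since |s| (1/|s|)^2 <= 1, the energy of the approximation is at most the second moment of the
    matching approximation of F. *)
Lemma gradient_energy_Linv : exists C : R, forall K,
  (\sum_(k < K) sq_moment P (path_gradient (Linv P F) k) <= C%:E)%E.
Proof.
have [Li Lc] := Linv_cvg; have Fi := sq_integrable_chaos.
pose B : R := 2 * fine (sq_moment P F) + 2; exists (2 + 2 * B) => K.
rewrite (eq_bigr (fun k : 'I_K => sq_moment P (path_gradient (fun w => - Linv P F w) k))); last first.
  move=> k _; rewrite -sq_momentN; congr sq_moment; apply/funext => w.
  by rewrite /path_gradient -mulNr opprB opprK addrC.
apply: gradient_energy_le; first exact: sq_integrableN.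
(* The cap at 1 keeps the bound B independent of e. *)
move=> e e0; have e' : 0 < Num.min e 1 by rewrite lt_min e0 ltr01.
have [m [M [h1 h2]]] := chaos_approx_joint e'.
exists (chaos_seqs m M), (chaos_coef_weighted g inv_weight); split.
- exact: chaos_seqs_uniq.
- exact: chaos_seqs_sorted.
- by apply: le_trans h2 _; rewrite lee_fin ge_min lexx.
have Ai := sq_integrable_walsh P (chaos_seqs m M) (chaos_coef_weighted g (fun=> 1)).
apply: (@le_trans _ _ (\sum_(s <- chaos_seqs m M) chaos_coef_weighted g (fun=> 1) s ^+ 2)).
  rewrite big_seq [leRHS]big_seq; apply: ler_sum => s.
  rewrite mem_chaos_seqs => /and4P[s0 _ _ _].
  rewrite /chaos_coef_weighted mul1r exprMn mulrA ler_piMl ?sqr_ge0//.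
  by rewrite expr2 mulrA mulfV ?pnatr_eq0 -?lt0n// mul1r invf_le1 ?ler1n// ltr0n.
rewrite -lee_fin -(sq_moment_walsh hP) ?chaos_seqs_uniq ?chaos_seqs_sorted//.
rewrite (_ : walsh _ _ = F \- (F \- chaos_approx g (fun=> 1) m M)); last first.
  by apply/funext => w /=; rewrite /chaos_approx; ring.
have FE : (sq_moment P F <= (fine (sq_moment P F))%:E)%E.
  by rewrite fineK// sq_moment_fin_num.
apply: le_trans (sq_momentB_le _ _ FE h1) _.
- by case: Fi.
- by case: (sq_integrableB Fi Ai).
- by rewrite lee_fin /B lerD2l ler_piMr// ge_min lexx orbT.
Qed.

(** The truncation to K coordinates of delta D G = -L G: as D_k G does not depend on coordinate k,
    the divergence is the plain sum of X_k D_k G. *)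
Definition rad_divergence K (G : Omega -> R) (w : Omega) : R :=
  \sum_(k < K) rad k w * path_gradient G k w.

Lemma rad_divergenceB K G H :
  rad_divergence K (G \- H) = rad_divergence K G \- rad_divergence K H.
Proof.
apply/funext => w; rewrite /rad_divergence /= -sumrB; apply: eq_bigr => k _.
by rewrite path_gradientB -mulrBr.
Qed.

Lemma sq_integrable_rad_divergence K G : sq_integrable P G ->
  sq_integrable P (rad_divergence K G).
Proof.
move=> Gi; apply: (sq_integrable_sum _ (p := xpredT)) => k _.
by apply: sq_integrable_rad; exact: sq_integrable_path_gradient.
Qed.

(** The constant grows with K, which is harmless because K is fixed before the approximation to
    which the bound is applied. *)
Lemma sq_moment_rad_divergence K : exists2 C : R, 0 <= C &
  forall G, sq_integrable P G ->
  (sq_moment P (rad_divergence K G) <= C%:E * sq_moment P G)%E.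
Proof.
elim: K => [|K [C C0 ih]].
  exists 0 => // G _; rewrite mul0e (_ : rad_divergence 0 G = fun=> 0).
    rewrite /sq_moment (eq_integral (cst 0%E)) ?integral0//.
    by move=> w _; rewrite expr0n.
  by apply/funext => w; rewrite /rad_divergence big_ord0.
exists (2 * C + 2); first by rewrite addr_ge0// mulr_ge0.
move=> G Gi; have gi := sq_integrable_path_gradient hP K Gi.
rewrite (_ : rad_divergence K.+1 G = rad_divergence K G \+
  (fun w => rad K w * path_gradient G K w)); last first.
  by apply/funext => w; rewrite /rad_divergence big_ord_recr.
have GE := fineK (sq_moment_fin_num Gi); set a := fine _ in GE.
have h1 : (sq_moment P (rad_divergence K G) <= (C * a)%:E)%E.
  by rewrite EFinM GE; exact: ih.
have h2 : (sq_moment P (fun w => rad K w * path_gradient G K w)%R <= a%:E)%E.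
  by rewrite sq_moment_rad GE; apply: sq_moment_path_gradient => //; case: Gi.
rewrite -GE -EFinM; apply: le_trans (sq_momentD_le _ _ h1 h2) _.
- by case: (sq_integrable_rad_divergence K Gi).
- by case: (sq_integrable_rad K gi).
- by rewrite lee_fin; lra.
Qed.

Lemma rad_divergence_walsh K (L : seq (seq nat)) (c : seq nat -> R) :
  all (sorted ltn) L -> rad_divergence K (walsh L c) =
  walsh L (fun s => (count (fun i => (i < K)%N) s)%:R * c s).
Proof.
move=> sL; apply/funext => w; rewrite /rad_divergence.
rewrite (eq_bigr (fun k : 'I_K => walsh L (fun s => (val k \in s)%:R * c s) w)); last first.
  by move=> k _; rewrite rad_path_gradient_walsh.
rewrite /walsh exchange_big /= big_seq [RHS]big_seq; apply: eq_bigr => s /(allP sL) ss.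
by rewrite -mulr_suml -mulr_suml -natr_sum sum_mem_count ?sorted_ltn_uniq.
Qed.

(* delta D L^{-1} F = - F: multiplying the Walsh coefficient at s by
   #{i in s : i < K} / #|s| is a contraction, and equals the identity on the
   coordinates below K. *)
Lemma rad_divergence_cvg :
  sq_cvg P (fun K => rad_divergence K (fun w => - Linv P F w)) F.
Proof.
have [Li Lc] := Linv_cvg; have Fi := sq_integrable_chaos.
set Y := fun w => - Linv P F w; have Yi : sq_integrable P Y := sq_integrableN Li.
(* The final estimate adds 2 e' and 2 (2 * 4 e' + 2 e'). *)
move=> e e0; pose e' := e / 22; have e'0 : 0 < e' by rewrite divr_gt0.
have [m [M [h1 _]]] := chaos_approx_joint e'0.
exists M => K MK.
have [C C0 hC] := sq_moment_rad_divergence K.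
(* A second, finer approximation is chosen after K, since C depends on K; the coarse one decides how
   large K has to be. *)
have e''0 : 0 < e' / (C + 1) by rewrite divr_gt0// ltr_wpDl.
have e2 : 0 < Num.min e' (e' / (C + 1)) by rewrite lt_min e'0 e''0.
have [m' [M' [h1' h2']]] := chaos_approx_joint e2.
pose b s : R := (count (fun i => (i < K)%N) s)%:R * (size s)%:R^-1.
have TE n N : rad_divergence K (chaos_approx g inv_weight n N) =
    walsh (chaos_seqs n N) (fun s => b s * chaos_coef_weighted g (fun=> 1) s).
  rewrite rad_divergence_walsh ?chaos_seqs_sorted//; congr walsh; apply/funext => s.
  by rewrite /b /chaos_coef_weighted mul1r mulrA.
(* On the coarse approximation all indices are below M <= K, so the multiplier is 1. *)
have TM : rad_divergence K (chaos_approx g inv_weight m M) = chaos_approx g (fun=> 1) m M.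
  rewrite TE /chaos_approx; apply/funext => w; rewrite /walsh big_seq [RHS]big_seq.
  apply: eq_bigr => s; rewrite mem_chaos_seqs => /and4P[s0 _ _ sM].
  rewrite /b (eqP (_ : count _ s == size s)) ?mulfV ?mul1r ?pnatr_eq0 -?lt0n//.
  by rewrite -all_count; apply: sub_all sM => i iM; exact: leq_trans MK.
have b1 s : `|b s| <= 1.
  rewrite ger0_norm ?mulr_ge0 ?invr_ge0//; have [s0|s0] := posnP (size s).
    by rewrite /b s0 invr0 mulr0.
  by rewrite ler_pdivrMr ?ltr0n// mul1r ler_nat count_size.
have Ai n N b' : sq_integrable P (chaos_approx g b' n N) by exact: sq_integrable_walsh.
have k1 : (sq_moment P (rad_divergence K (Y \- chaos_approx g inv_weight m' M')%R) <= e'%:E)%E.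
  apply: le_trans (hC _ (sq_integrableB Yi (Ai _ _ _))) _.
  apply: le_trans (lee_wpmul2l _ h2') _; first by rewrite lee_fin.
  rewrite -EFinM lee_fin; apply: (@le_trans _ _ (C * (e' / (C + 1)))).
    by rewrite ler_wpM2l// ge_min lexx orbT.
  rewrite mulrCA ler_piMr// ?(ltW e'0)// ler_pdivrMr ?ltr_wpDl// mul1r lerDl.
  exact: ler01.
(* The multiplier b is bounded by 1 for every K, so this comparison of the fine and the coarse
   approximation is uniform in K. *)
have k2 : (sq_moment P (rad_divergence K (chaos_approx g inv_weight m' M') \-
    rad_divergence K (chaos_approx g inv_weight m M))%R <= (4 * e')%:E)%E.
  rewrite !TE; have := @sq_moment_walshB_le R P hP (chaos_seqs m' M') (chaos_seqs m M)
    (chaos_coef_weighted g (fun=> 1)) b 1 ler01 (chaos_seqs_uniq _ _)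
    (chaos_seqs_uniq _ _) (chaos_seqs_sorted _ _) (chaos_seqs_sorted _ _)
    (fun s _ => b1 s).
  rewrite expr1n mul1e => /le_trans; apply.
  rewrite (_ : _ \- _ = (F \- chaos_approx g (fun=> 1) m M) \-
     (F \- chaos_approx g (fun=> 1) m' M')); last first.
    by apply/funext => w /=; rewrite /chaos_approx; ring.
  have h1'' : (sq_moment P (F \- chaos_approx g (fun=> 1) m' M')%R <= e'%:E)%E.
    by apply: le_trans h1' _; rewrite lee_fin ge_min lexx.
  apply: le_trans (sq_momentB_le _ _ h1 h1'') _.
  - by case: (sq_integrableB Fi (Ai m M (fun=> 1))).
  - by case: (sq_integrableB Fi (Ai m' M' (fun=> 1))).
  - by rewrite lee_fin; lra.
pose A := rad_divergence K (Y \- chaos_approx g inv_weight m' M').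
pose B := rad_divergence K (chaos_approx g inv_weight m' M') \-
  rad_divergence K (chaos_approx g inv_weight m M).
have Aint : sq_integrable P A.
  by apply: sq_integrable_rad_divergence; exact: sq_integrableB.
have Bint : sq_integrable P B.
  by apply: sq_integrableB; exact: sq_integrable_rad_divergence.
have Cint := sq_integrableB Fi (Ai m M (fun=> 1)).
have BC := sq_momentB_le Bint.1 Cint.1 k2 h1.
rewrite (_ : _ \- _ = A \+ (B \- (F \- chaos_approx g (fun=> 1) m M))); last first.
  by apply/funext => w; rewrite /A /B rad_divergenceB TM /=; ring.
apply: le_trans (sq_momentD_le Aint.1 (sq_integrableB Bint Cint).1 k1 BC) _.
by rewrite lee_fin /e'; lra.
Qed.

End inverse_generator.

(** The approximations are built from the kernels that witness [dom_D], so that its finite sum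
    bounds their energy directly, with no comparison to [chaos_kernels]. *)
Lemma gradient_energy_dom_D (R : realType) (P : probability Omega R)
    (hP : is_rademacher_measure P) (F : Omega -> R) :
  dom_D P F -> ('E_P[F] = 0)%E -> exists C : R, forall K,
  (\sum_(k < K) sq_moment P (path_gradient F k) <= C%:E)%E.
Proof.
move=> [f Ff fD] F0; have fk n : is_kernel (f n) by case: Ff.
have t0 n : (0 <= (n * n`!)%:R%:E * sq_norm (f n))%E.
  by rewrite mule_ge0 ?lee_fin//; apply: esum_ge0 => t _; rewrite lee_fin sqr_ge0.
set S := (\sum_(1 <= n <oo) _)%E in fD.
have S0 : (0 <= S)%E by apply: nneseries_ge0 => n _ _; exact: t0.
have SE : S = (fine S)%:E by rewrite fineK// ge0_fin_numE.
exists (2 + 2 * fine S) => K; apply: gradient_energy_le => //.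
  exact: (sq_integrable_chaos Ff).
move=> e e0.
have [m0 /(_ m0 (leqnn _))[M0 /(_ M0 (leqnn _)) h]] := chaos_approx_exists hP fk
  (sq_integrable_chaos Ff) (chaos_decomposition_cvg F0 Ff) e0.
exists (chaos_seqs m0 M0), (chaos_coef_weighted f (fun=> 1)); split => //.
- exact: chaos_seqs_uniq.
- exact: chaos_seqs_sorted.
rewrite chaos_energyE -lee_fin -SE -sumEFin.
apply: le_trans (nneseries_lim_ge m0.+1 (fun n _ _ => t0 n)).
apply: lee_sum => n _; rewrite natrM !EFinM -muleA.
by apply: lee_wpmul2l; [rewrite lee_fin|exact: kernel_coef_energy].
Qed.

(** * The Kolmogorov distance *)

Section gradient_pairing.
Context {R : realType} (P : probability Omega R).
Context (hP : is_rademacher_measure P).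
Context (F U : Omega -> R) (Fi : sq_integrable P F) (Ui : sq_integrable P U).
Context (CF CU : R).
Context (eF : forall K, (\sum_(k < K) sq_moment P (path_gradient F k) <= CF%:E)%E).
Context (eU : forall K, (\sum_(k < K) sq_moment P (path_gradient U k) <= CU%:E)%E).

Definition gradient_product k w : R := path_gradient F k w * - path_gradient U k w.

Let gFi k := sq_integrable_path_gradient hP k Fi.
Let gUi k := sq_integrable_path_gradient hP k Ui.

Lemma measurable_gradient_product k :
  measurable_fun [set: Omega] (gradient_product k).
Proof. by apply: measurable_funM; [case: (gFi k)|apply: measurable_funN; case: (gUi k)]. Qed.

Lemma integral_gradient_product_le k :
  (\int[P]_w `|gradient_product k w|%:E <=
   sq_moment P (path_gradient F k) + sq_moment P (path_gradient U k))%E.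
Proof.
have [mF _] := gFi k; have [mU _] := gUi k.
rewrite /sq_moment -ge0_integralD//; last 4 first.
- by move=> w _; rewrite lee_fin sqr_ge0.
- exact: measurable_sq.
- by move=> w _; rewrite lee_fin sqr_ge0.
- exact: measurable_sq.
apply: ge0_le_integral => //.
- apply/measurable_EFinP; apply: measurableT_comp => //.
  exact: measurable_gradient_product.
- by apply: emeasurable_funD; exact: measurable_sq.
- move=> w _; rewrite -EFinD lee_fin normrM normrN.
  rewrite -(real_normK (num_real (path_gradient F k w))).
  rewrite -(real_normK (num_real (path_gradient U k w))).
  by have := sqr_ge0 (`|path_gradient F k w| - `|path_gradient U k w|);
    have := sqr_ge0 (`|path_gradient F k w| + `|path_gradient U k w|); nra.
Qed.

(** The pairing is extended-real valued; q is a real version of it. By |u v| <= u^2 + v^2 and the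
    two energy bounds, the series of absolute values is integrable, and it dominates the partial
    sums. *)
Lemma l2_inner_gradient_cvg : exists q : Omega -> R,
  [/\ P.-integrable setT (EFin \o q),
   {ae P, forall w, l2_inner (path_gradient F ^~ w)
      (fun k => - path_gradient U k w) = (q w)%:E} &
   forall e : R, 0 < e -> exists K0, forall K, (K0 <= K)%N ->
     (\int[P]_w `|\sum_(k < K) gradient_product k w - q w|%:E <= e%:E)%E].
Proof.
have mp := measurable_gradient_product.
have map k : measurable_fun setT (fun w => `|gradient_product k w|%:E).
  by apply/measurable_EFinP; apply: measurableT_comp.
pose g w : \bar R := (\sum_(0 <= k <oo) `|gradient_product k w|%:E)%E.
have g0 w : (0 <= g w)%E by apply: nneseries_ge0 => k _ _; rewrite lee_fin.
have mg : measurable_fun setT g by apply: ge0_emeasurable_sum => // k w _ _; rewrite lee_fin.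
have ig : P.-integrable setT g.
  apply/integrableP; split => //; under eq_integral do rewrite gee0_abs//.
  rewrite integral_nneseries//.
  apply: (@le_lt_trans _ _ (CF + CU)%:E); last exact: ltry.
  apply: lime_le.
    by apply: is_cvg_nneseries => k _ _; apply: integral_ge0 => w _; rewrite lee_fin.
  apply: nearW => n; rewrite big_mkord EFinD.
  apply: le_trans (leeD (eF n) (eU n)); rewrite -big_split /=.
  by apply: lee_sum => k _; exact: integral_gradient_product_le.
pose A := [set w | (g w < +oo)%E].
have mA : measurable A by rewrite -[A]setTI; exact: emeasurable_fun_infty_o.
have aeA : {ae P, forall w, A w}.
  by apply: filterS (integrable_ae measurableT ig) => w /(_ I); rewrite /A /= ge0_fin_numE.
pose s n w : R := \sum_(k < n) gradient_product k w.
have ms n : measurable_fun setT (s n) by exact: measurable_sum.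
have sc w : A w -> cvgn (s ^~ w).
  move=> Aw; rewrite (_ : s ^~ w = series (gradient_product ^~ w)); last first.
    by apply/funext => n; rewrite /series /= big_mkord.
  by apply: normed_cvg; apply: nnseries_is_cvg => // k; exact: normr_ge0.
pose sA n w : R := s n w * \1_A w.
have sAE n w : A w -> sA n w = s n w by move=> Aw; rewrite /sA indicE mem_set// mulr1.
have sAc w : cvgn (sA ^~ w).
  have [wA|wA] := pselect (A w).
    rewrite (_ : sA ^~ w = s ^~ w); first exact: sc.
    by apply/funext => n; exact: sAE.
  rewrite (_ : sA ^~ w = cst 0); first exact: is_cvg_cst.
  by apply/funext => n; rewrite /sA indicE memNset// mulr0.
have msA n : measurable_fun setT (sA n).
  exact: (measurable_funM (ms n) (measurable_indic mA)).
pose q w : R := limn (sA ^~ w).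
have mq : measurable_fun setT q by apply: (measurable_fun_cvg msA) => w _; exact: sAc.
have sq w : A w -> s n w @[n --> \oo] --> q w.
  move=> Aw; rewrite /q (_ : sA ^~ w = s ^~ w); first exact: sc.
  by apply/funext => n; exact: sAE.
have [] := @dominated_convergence _ _ _ P setT measurableT
  (fun n w => (s n w)%:E) (EFin \o q) g.
- by move=> n; exact/measurable_EFinP.
- exact/measurable_EFinP.
- apply: filterS aeA => w Aw _; apply: cvg_EFin; first exact: nearW.
  exact: sq.
- exact: ig.
- apply: filterS aeA => w Aw n _; rewrite abse_EFin.
  apply: le_trans (_ : (\sum_(k < n) `|gradient_product k w|%:E <= _)%E).
    by rewrite sumEFin lee_fin ler_norm_sum.
  by rewrite -(big_mkord xpredT (fun k => `|gradient_product k w|%:E)); exact: nneseries_lim_ge.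
move=> iq /= cv _; exists q; split => //.
  apply: filterS aeA => w Aw; apply/cvg_lim => //.
  rewrite (_ : (fun n => _) = (fun n => (s n w)%:E)); last first.
    by apply/funext => n; rewrite big_mkord sumEFin.
  by apply: cvg_EFin; [exact: nearW|exact: sq].
move=> e e0.
have /fine_cvgP[fn /cvgrPdist_le/(_ _ e0) fl] := cv.
have [K _ hK] := filterI fn fl; exists K => n Kn.
have [/= {}fn {}fl] := hK n Kn.
rewrite -[leLHS]fineK// lee_fin.
by apply: le_trans (ler_norm _) _; rewrite -[`|_|]normrN -[X in `|X|]sub0r.
Qed.

End gradient_pairing.

Section stein_solution_measurability.
Context {R : realType}.
Implicit Types x z : R.

Lemma continuous_stein_sol x : continuous (stein_sol x).
Proof.
move=> z; apply/cvgrPdist_lt => e e0; near=> y.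
apply: le_lt_trans (stein_sol_lip x y z) _.
by near: y; apply: cvgr_dist_lt.
Unshelve. all: by end_near. Qed.

Lemma measurable_stein_sol x : measurable_fun [set: R] (stein_sol x).
Proof. by apply: continuous_measurable_fun; exact: continuous_stein_sol. Qed.

Lemma measurable_stein_sol' x : measurable_fun [set: R] (stein_sol' x).
Proof.
apply: measurable_funB => //; apply: measurable_funD.
  by apply: measurable_funM => //; exact: measurable_stein_sol.
rewrite (_ : (fun z => _) = \1_`]-oo, x]%classic); first exact: measurable_indic.
by apply/funext => z; rewrite indicE mem_setE in_itv.
Qed.

End stein_solution_measurability.

Section integral_bounds.
Context d (T : measurableType d) (R : realType) (P : probability T R).

Lemma abs_Rintegral_le (phi : T -> R) (b : T -> \bar R) :
  P.-integrable setT (EFin \o phi) -> measurable_fun setT b ->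
  (forall w, `|phi w|%:E <= b w)%E ->
  (`|\int[P]_w phi w|%:E <= \int[P]_w b w)%E.
Proof.
move=> phii mb phib.
rewrite /Rintegral -abse_EFin fineK; last exact: integrable_fin_num.
apply: le_trans (le_abse_integral P measurableT (measurable_int _ phii)) _.
apply: ge0_le_integral => //; last by move=> w _; exact: phib.
by apply: measurableT_comp => //; exact: (measurable_int _ phii).
Qed.

Lemma sq_integrable_boundedM (h f : T -> R) (c : R) :
  measurable_fun setT h -> (forall w, `|h w| <= c) -> sq_integrable P f ->
  sq_integrable P (fun w => h w * f w).
Proof.
move=> mh hc [mf fi]; split; first exact: measurable_funM.
apply: le_lt_trans (sq_integrableZ c (conj mf fi)).2.
apply: le_sq_moment => [||w]; [exact: measurable_funM..|].
rewrite !exprMn ler_wpM2r ?sqr_ge0// -[leLHS]real_normK ?num_real//.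
by rewrite lerXn2r ?nnegrE//; exact: le_trans (hc w).
Qed.

Lemma sum_integral_le_l2_inner (u v : nat -> T -> R) K :
  (forall k, measurable_fun setT (u k)) -> (forall k, measurable_fun setT (v k)) ->
  (forall k w, 0 <= u k w * v k w) ->
  (\sum_(k < K) \int[P]_w (u k w * v k w)%:E <=
   \int[P]_w l2_inner (u ^~ w) (v ^~ w))%E.
Proof.
move=> mu mv uv0; rewrite integral_nneseries//.
- rewrite -(big_mkord xpredT (fun k => \int[P]_w (u k w * v k w)%:E)%E).
  apply: nneseries_lim_ge => k _ _; apply: integral_ge0 => w _.
  by rewrite lee_fin.
- by move=> k; apply/measurable_EFinP; exact: measurable_funM.
- by move=> k w _; rewrite lee_fin.
Qed.

End integral_bounds.

(** * The bound at a fixed x, for pathwise gradients *)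

Section stein_bound.
Context {R : realType} (P : probability Omega R).
Context (hP : is_rademacher_measure P).
Context (F U : Omega -> R) (Fi : sq_integrable P F) (Ui : sq_integrable P U).
Context (CF CU : R).
Context (eF : forall K, (\sum_(k < K) sq_moment P (path_gradient F k) <= CF%:E)%E).
Context (eU : forall K, (\sum_(k < K) sq_moment P (path_gradient U k) <= CU%:E)%E).
Context (divU : sq_cvg P (fun K => rad_divergence K (fun w => - U w)) F).
Variable x : R.

Local Notation C := (@gauss_const R / 4).
Local Notation G := (fun w => stein_sol x (F w)).
Local Notation H := (fun w => stein_sol' x (F w)).
Local Notation I1 := (\1_[set v : Omega | x < F v] : Omega -> R).

(** The indicator of ]x, +oo[ is nondecreasing, so D_k F and D_k 1_{F > x} never have opposite
    signs. *)
Lemma path_gradient_indic_ge0 k w :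
  0 <= path_gradient F k w * path_gradient I1 k w.
Proof.
rewrite /path_gradient !indicE !mem_setE.
set a := F _; set b := F _.
have : 0 <= (a - b) * ((x < a)%R%:R - (x < b)%R%:R).
  case: (ltP x a) => xa; case: (ltP x b) => xb; rewrite ?subrr ?mulr0 ?subr0 ?sub0r//=.
    by rewrite mulr1; lra.
  by rewrite mulrN1; lra.
nra.
Qed.

(** Taylor's estimate from a = F(w) to b, the value at the flipped point. Since b - a = -2 X_k D_k
    F, half of (b - a)^2 / 2 is (D_k F)^2, and half of |b - a| times the jump is 2 D_k F D_k 1_{F >
    x}. *)
Lemma stein_remainder_le k w :
  `|path_gradient G k w - H w * path_gradient F k w| <=
  (`|F w| + C) * path_gradient F k w ^+ 2
  + 2 * (path_gradient F k w * path_gradient I1 k w).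
Proof.
have := path_gradient_indic_ge0 k w.
rewrite !path_gradientE; set a := F w; set b := F (flip k w).
have := stein_sol_taylor x a b.
rewrite !indicE !mem_setE -/a -/b.
set ra := rad k w; have ra2 : ra ^+ 2 = 1 by rewrite expr2 rad_sqr.
set t := stein_sol x b - _ - _ => ht.
set ia := (x < a)%R%:R; set ib := (x < b)%R%:R => iab.
have -> : ra * (stein_sol x a - stein_sol x b) / 2 - stein_sol' x a * (ra * (a - b) / 2)
   = - (ra * t / 2) by rewrite /t; field.
rewrite normrN !normrM norm_rad mul1r (ger0_norm (_ : 0 <= 2^-1)) ?invr_ge0//.
have e1 : (ra * (a - b) / 2) ^+ 2 = (b - a) ^+ 2 / 4.
  by rewrite !exprMn ra2; field.
have e2 : ra * (a - b) / 2 * (ra * (ia - ib) / 2) = (a - b) * (ia - ib) / 4.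
  transitivity (ra ^+ 2 * ((a - b) * (ia - ib) / 4)); last by rewrite ra2 mul1r.
  by field.
rewrite e2 in iab *; rewrite e1.
have e3 : `|b - a| * `|(a <= x)%R%:R - (b <= x)%R%:R| = (a - b) * (ia - ib).
  rewrite -normrM -[RHS]ger0_norm; last by lra.
  congr `|_|; rewrite /ia /ib !ltNge.
  by case: (a <= x); case: (b <= x); rewrite /= ?mulr1n ?mulr0n; ring.
rewrite e3 in ht.
have : `|t| / 2 <= ((`|a| + C) * ((b - a) ^+ 2 / 2) + (a - b) * (ia - ib)) / 2.
  by rewrite ler_pM2r ?invr_gt0.
by move/le_trans; apply; rewrite le_eqVlt; apply/orP; left; apply/eqP; field.
Qed.

Local Notation remainder_bound := (fun k w =>
  (((`|F w| + C) * path_gradient F k w ^+ 2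
   + 2 * (path_gradient F k w * path_gradient I1 k w)) * `|path_gradient U k w|)%:E).

Let mF : measurable_fun setT F. Proof. by case: Fi. Qed.
Let mgF k : measurable_fun setT (path_gradient F k).
Proof. by case: (sq_integrable_path_gradient hP k Fi). Qed.
Let mgU k : measurable_fun setT (path_gradient U k).
Proof. by case: (sq_integrable_path_gradient hP k Ui). Qed.
Let mgI k : measurable_fun setT (path_gradient I1 k).
Proof.
apply: measurable_path_gradient; apply: measurable_indic.
rewrite (_ : [set v | _] = F @^-1` `]x, +oo[%classic).
  by rewrite -[X in measurable X]setTI; exact: mF.
by apply/seteqP; split => v /=; rewrite in_itv/= andbT.
Qed.
Let C0 : 0 <= C. Proof. by rewrite divr_ge0// ltW// gauss_const_gt0. Qed.

Lemma measurable_remainder_bound k : measurable_fun setT (remainder_bound k).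
Proof.
apply/measurable_EFinP; apply: measurable_funM; last exact: measurableT_comp.
apply: measurable_funD; last first.
  by apply: measurable_funM => //; exact: measurable_funM.
apply: measurable_funM; last exact: measurable_funX.
by apply: measurable_funD => //; exact: measurableT_comp.
Qed.

Lemma remainder_bound_ge0 k w : (0 <= remainder_bound k w)%E.
Proof.
rewrite lee_fin mulr_ge0// addr_ge0//.
  by rewrite mulr_ge0 ?sqr_ge0// addr_ge0.
by rewrite mulr_ge0// path_gradient_indic_ge0.
Qed.

Lemma sum_remainder_bound_le K :
  (\sum_(k < K) \int[P]_w remainder_bound k w <=
   C%:E * \int[P]_w l2_inner (fun k => path_gradient F k w ^+ 2)%R
                             (fun k => `|path_gradient U k w|)%R
   + \int[P]_w l2_inner (fun k => path_gradient F k w ^+ 2)%R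
                        (fun k => `|F w * path_gradient U k w|)%R
   + 2%:E * \int[P]_w l2_inner (fun k => path_gradient F k w * path_gradient I1 k w)%R
                               (fun k => `|path_gradient U k w|)%R)%E.
Proof.
pose t2 k w : R := path_gradient F k w ^+ 2 * `|path_gradient U k w|.
pose t3 k w : R := path_gradient F k w ^+ 2 * `|F w * path_gradient U k w|.
pose t4 k w : R := path_gradient F k w * path_gradient I1 k w * `|path_gradient U k w|.
have mF2 k : measurable_fun setT (fun w => path_gradient F k w ^+ 2).
  exact: measurable_funX.
have mFI k : measurable_fun setT (fun w => path_gradient F k w * path_gradient I1 k w).
  exact: measurable_funM.
have mU k : measurable_fun setT (fun w => `|path_gradient U k w|) by exact: measurableT_comp.
have mFU k : measurable_fun setT (fun w => `|F w * path_gradient U k w|).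
  by apply: measurableT_comp => //; exact: measurable_funM.
have t20 k w : 0 <= t2 k w by rewrite mulr_ge0 ?sqr_ge0.
have t30 k w : 0 <= t3 k w by rewrite mulr_ge0 ?sqr_ge0.
have t40 k w : 0 <= t4 k w by rewrite mulr_ge0 ?path_gradient_indic_ge0.
have mt2 k : measurable_fun setT (fun w => (t2 k w)%:E).
  by apply/measurable_EFinP; exact: measurable_funM.
have mt3 k : measurable_fun setT (fun w => (t3 k w)%:E).
  by apply/measurable_EFinP; exact: measurable_funM.
have mt4 k : measurable_fun setT (fun w => (t4 k w)%:E).
  by apply/measurable_EFinP; exact: measurable_funM.
have E k : (\int[P]_w remainder_bound k w = C%:E * \int[P]_w (t2 k w)%:E +
    \int[P]_w (t3 k w)%:E + 2%:E * \int[P]_w (t4 k w)%:E)%E.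
  rewrite -!ge0_integralZl_EFin//; last 2 first.
  - by move=> w _; rewrite lee_fin.
  - by move=> w _; rewrite lee_fin.
  rewrite -ge0_integralD//; last 3 first.
  - by move=> w _; rewrite mule_ge0// lee_fin.
  - exact: measurable_funeM.
  - by move=> w _; rewrite lee_fin.
  rewrite -ge0_integralD//; last 4 first.
  - by move=> w _; rewrite adde_ge0// ?mule_ge0// lee_fin.
  - by apply: emeasurable_funD => //; exact: measurable_funeM.
  - by move=> w _; rewrite mule_ge0// lee_fin.
  - exact: measurable_funeM.
  apply: eq_integral => w _; rewrite -!EFinM -!EFinD; congr (_%:E).
  by rewrite /t2 /t3 /t4 (normrM (F w)); ring.
rewrite (eq_bigr _ (fun k _ => E (val k))) 2!big_split /=.
have i0 (t : nat -> Omega -> R) k : (forall k w, 0 <= t k w) ->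
    (0 <= \int[P]_w (t k w)%:E)%E.
  by move=> t0; apply: integral_ge0 => w _; rewrite lee_fin.
have sZ (a : R) (t : nat -> Omega -> R) : (forall k w, 0 <= t k w) ->
    (\sum_(k < K) a%:E * \int[P]_w (t k w)%:E = a%:E * \sum_(k < K) \int[P]_w (t k w)%:E)%E.
  by move=> t0; rewrite ge0_sume_distrr// => k _; exact: i0.
rewrite !sZ//.
apply: leeD; first apply: leeD.
- apply: lee_wpmul2l; first by rewrite lee_fin.
  apply: (@sum_integral_le_l2_inner _ _ _ P (fun k w => path_gradient F k w ^+ 2)
    (fun k w => `|path_gradient U k w|) K) => //.
- apply: (@sum_integral_le_l2_inner _ _ _ P (fun k w => path_gradient F k w ^+ 2)
    (fun k w => `|F w * path_gradient U k w|) K) => //.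
- apply: lee_wpmul2l; first by rewrite lee_fin.
  apply: (@sum_integral_le_l2_inner _ _ _ P
    (fun k w => path_gradient F k w * path_gradient I1 k w)
    (fun k w => `|path_gradient U k w|) K) => //.
Qed.

Let mG : measurable_fun setT G.
Proof. by apply: measurableT_comp mF; exact: measurable_stein_sol. Qed.

Let GC w : `|G w| <= C.
Proof. by rewrite ger0_norm ?stein_sol_ge0 ?stein_sol_le. Qed.

Let mH : measurable_fun setT H.
Proof. by apply: measurableT_comp mF; exact: measurable_stein_sol'. Qed.

Let Gi : sq_integrable P G. Proof. exact: sq_integrable_bounded mG GC. Qed.

Let HgFi k : sq_integrable P (fun w => H w * path_gradient F k w).
Proof.
apply: (sq_integrable_boundedM mH) => [w|]; first exact: stein_sol'_le1.
exact: sq_integrable_path_gradient.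
Qed.

Let gGi k := sq_integrable_path_gradient hP k Gi.
Let gUi k := sq_integrable_path_gradient hP k Ui.

Lemma measurable_le_set : measurable [set w | F w <= x].
Proof.
rewrite (_ : [set w | _] = F @^-1` `]-oo, x]%classic).
  by rewrite -[X in measurable X]setTI; exact: mF.
by apply/seteqP; split => w /=; rewrite in_itv.
Qed.

Lemma stein_identity :
  fine (P [set w | F w <= x]) - normal_cdf x = \int[P]_w (H w - F w * G w).
Proof.
have mS := measurable_le_set.
transitivity (\int[P]_w (\1_[set w | F w <= x] w - normal_cdf x)); last first.
  by apply: eq_Rintegral => w _; rewrite /stein_sol' indicE mem_setE; ring.
rewrite RintegralB//; last 2 first.
- exact: integrable_indic.
- exact: finite_measure_integrable_cst.
by rewrite Rintegral_prob_cst /Rintegral integral_indic// setIT.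
Qed.

(** One integration by parts per coordinate, possible because D_k U does not depend on coordinate
    k. *)
Lemma Rintegral_divergence K :
  \int[P]_w (rad_divergence K (fun w => - U w) w * G w) =
  \int[P]_w (\sum_(k < K) - path_gradient U k w * path_gradient G k w).
Proof.
have nUi := sq_integrableN Ui.
have E k : path_gradient (fun w => - U w) k = fun w => - path_gradient U k w.
  by apply/funext => w; rewrite /path_gradient; field.
elim: K => [|K ih].
  apply: eq_Rintegral => w _; by rewrite /rad_divergence !big_ord0 mul0r.
under [RHS]eq_Rintegral do rewrite big_ord_recr /=.
transitivity (\int[P]_w (rad_divergence K (fun w => - U w) w * G w +
  rad K w * path_gradient (fun w => - U w) K w * G w)).
  by apply: eq_Rintegral => w _; rewrite /rad_divergence big_ord_recr /= mulrDl.
rewrite RintegralD//; last 2 first.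
- exact: sq_integrable_mul (sq_integrable_rad_divergence hP K nUi) Gi.
- exact: sq_integrable_mul (sq_integrable_rad K (sq_integrable_path_gradient hP K nUi)) Gi.
rewrite ih (Rintegral_rad_by_parts hP (sq_integrable_path_gradient hP K nUi) Gi); last first.
  by move=> w; exact: path_gradient_flip.
rewrite E -RintegralD//; last first.
  exact: sq_integrable_mul (sq_integrableN (gUi K)) (gGi K).
rewrite (_ : EFin \o _ = fun w => (\sum_(k < K) (- path_gradient U k w * path_gradient G k w)%:E)%E).
  apply: integrable_sum => // k _.
  exact: sq_integrable_mul (sq_integrableN (gUi k)) (gGi k).
by apply/funext => w; rewrite /= -sumEFin.
Qed.

Lemma stein_bound :
  (`|P [set w | (F w <= x)%R] - (normal_cdf x)%:E| <=
   \int[P]_w `|1 - l2_inner (path_gradient F ^~ w) (fun k => - path_gradient U k w)%R|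
   + C%:E * \int[P]_w l2_inner (fun k => path_gradient F k w ^+ 2)%R
                             (fun k => `|path_gradient U k w|)%R
   + \int[P]_w l2_inner (fun k => path_gradient F k w ^+ 2)%R
                        (fun k => `|F w * path_gradient U k w|)%R
   + 2%:E * \int[P]_w l2_inner (fun k => path_gradient F k w * path_gradient I1 k w)%R
                               (fun k => `|path_gradient U k w|)%R)%E.
Proof.
have [q [iq lq qcv]] := l2_inner_gradient_cvg hP Fi Ui eF eU.
have mq := measurable_int _ iq.
rewrite (ae_eq_integralT (g := fun w => `|1 - q w|%:E)); last first.
  by apply: filterS lq => w ->; rewrite -EFinB.
have addA4 (a b c e : \bar R) : (a + b + c + e = a + (b + c + e))%E by rewrite !addeA.
rewrite addA4; set T1 := (\int[P]_w `|1 - q w|%:E)%E; set RR := (X in (_ <= T1 + X)%E).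
rewrite -(fineK (fin_num_measure P _ measurable_le_set)) -EFinB abse_EFin.
apply/lee_addgt0Pr => e e0.
have e2 : 0 < e / 2 by rewrite divr_gt0.
have [K1 hK1] := qcv _ e2.
(* With second moment at most eta^2, the divergence error costs at most 2 C eta <= e / 2. *)
pose eta := e / 4 / (C + 1).
have eta0 : 0 < eta by rewrite !divr_gt0// ltr_wpDl.
have [K2 hK2] := divU (exprn_gt0 2 eta0).
pose K := maxn K1 K2.
have {}hK1 := hK1 K (leq_maxl _ _); have {}hK2 := hK2 K (leq_maxr _ _).
pose fK w : R := \sum_(k < K) gradient_product F U k w.
pose ZK w : R := \sum_(k < K) - path_gradient U k w * path_gradient G k w.
pose HK w : R := \sum_(k < K) (H w * path_gradient F k w) * - path_gradient U k w.
pose TK := rad_divergence K (fun w => - U w).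
have HKE w : HK w = H w * fK w.
  by rewrite /HK /fK mulr_sumr; apply: eq_bigr => k _; rewrite /gradient_product mulrA.
have TKi : sq_integrable P TK by apply: sq_integrable_rad_divergence => //; exact: sq_integrableN.
have iH : P.-integrable setT (EFin \o H).
  apply: sq_integrable_integrable; apply: (sq_integrable_bounded _ mH (c := 1)).
  by move=> w; exact: stein_sol'_le1.
have iHK : P.-integrable setT (EFin \o HK).
  rewrite (_ : EFin \o _ = fun w => (\sum_(k < K) ((H w * path_gradient F k w) * - path_gradient U k w)%:E)%E).
    by apply: integrable_sum => // k _; exact: sq_integrable_mul (HgFi k) (sq_integrableN (gUi k)).
  by apply/funext => w; rewrite /= -sumEFin.
have iZK : P.-integrable setT (EFin \o ZK).
  rewrite (_ : EFin \o _ = fun w => (\sum_(k < K) (- path_gradient U k w * path_gradient G k w)%:E)%E).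
    by apply: integrable_sum => // k _; exact: sq_integrable_mul (sq_integrableN (gUi k)) (gGi k).
  by apply/funext => w; rewrite /= -sumEFin.
have iFG := sq_integrable_mul Fi Gi.
have iTG := sq_integrable_mul TKi Gi.
(* H - F G is split into the pairing error, the Taylor remainder and the divergence error; E[TK G] =
   E[ZK] closes the balance. *)
have dE : fine (P [set w | F w <= x]) - normal_cdf x =
    \int[P]_w (H w - HK w) - \int[P]_w (ZK w - HK w) + \int[P]_w ((TK w - F w) * G w).
  have d1 : \int[P]_w (H w - F w * G w) = \int[P]_w H w - \int[P]_w (F w * G w).
    exact: (RintegralB measurableT iH iFG).
  have d2 : \int[P]_w (H w - HK w) = \int[P]_w H w - \int[P]_w HK w.
    exact: (RintegralB measurableT iH iHK).
  have d3 : \int[P]_w (ZK w - HK w) = \int[P]_w ZK w - \int[P]_w HK w.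
    exact: (RintegralB measurableT iZK iHK).
  have d4 : \int[P]_w ((TK w - F w) * G w) =
      \int[P]_w (TK w * G w) - \int[P]_w (F w * G w).
    rewrite -(RintegralB measurableT iTG iFG).
    by apply: eq_Rintegral => w _; rewrite mulrBl.
  rewrite stein_identity d1 d2 d3 d4 Rintegral_divergence; ring.
rewrite dE.
apply: (@le_trans _ _ (`|\int[P]_w (H w - HK w)|%:E + `|\int[P]_w (ZK w - HK w)|%:E +
  `|\int[P]_w ((TK w - F w) * G w)|%:E)%E).
  rewrite -!EFinD lee_fin; apply: le_trans (ler_normD _ _) _.
  by rewrite lerD2r; apply: le_trans (ler_normB _ _) _.
have mfK : measurable_fun setT fK.
  by apply: measurable_sum => k; exact: measurable_gradient_product.
(* Here |H| <= 1 is used, and replacing the partial pairing by its limit q costs e / 2. *)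
have b1 : (`|\int[P]_w (H w - HK w)|%:E <= T1 + (e / 2)%:E)%E.
  have m1 : measurable_fun setT (fun w => `|1 - q w|%:E).
    apply/measurable_EFinP; apply: measurableT_comp => //.
    by apply: measurable_funB => //; exact/measurable_EFinP.
  have m2 : measurable_fun setT (fun w => `|fK w - q w|%:E).
    apply/measurable_EFinP; apply: measurableT_comp => //.
    by apply: measurable_funB => //; exact/measurable_EFinP.
  apply: le_trans (leeD (lexx T1) hK1); rewrite -ge0_integralD//.
  apply: abs_Rintegral_le.
  - exact: (integrableB measurableT iH iHK).
  - exact: emeasurable_funD.
  - move=> w; rewrite -EFinD lee_fin HKE.
    rewrite (_ : _ - _ = H w * ((1 - q w) - (fK w - q w))); last by ring.
    rewrite normrM; apply: le_trans (ler_normB _ _).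
    by rewrite ler_piMl// stein_sol'_le1.
have b2 : (`|\int[P]_w (ZK w - HK w)|%:E <= RR)%E.
  apply: le_trans (sum_remainder_bound_le K).
  rewrite -ge0_integral_sum//; last 2 first.
  - by move=> k; exact: measurable_remainder_bound.
  - by move=> k w _; exact: remainder_bound_ge0.
  apply: abs_Rintegral_le.
  - exact: (integrableB measurableT iZK iHK).
  - by apply: emeasurable_sum => k; exact: measurable_remainder_bound.
  - move=> w; rewrite sumEFin lee_fin /ZK /HK -sumrB.
    apply: le_trans (ler_norm_sum _ _ _) _; apply: ler_sum => k _.
    rewrite (_ : _ - _ = - (path_gradient U k w *
      (path_gradient G k w - H w * path_gradient F k w))); last by ring.
    by rewrite normrN normrM mulrC ler_wpM2r// stein_remainder_le.
have b3 : (`|\int[P]_w ((TK w - F w) * G w)|%:E <= (e / 2)%:E)%E.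
  have TFi := sq_integrableB TKi Fi.
  have mTF : measurable_fun setT (TK \- F) by case: TFi.
  have m3 : measurable_fun setT (fun w => `|TK w - F w|%:E).
    by apply/measurable_EFinP; apply: measurableT_comp.
  apply: (@le_trans _ _ (\int[P]_w (C%:E * `|TK w - F w|%:E))%E).
    apply: abs_Rintegral_le.
    - exact: (sq_integrable_mul TFi Gi).
    - exact: measurable_funeM.
    - by move=> w; rewrite -EFinM lee_fin normrM mulrC ler_wpM2r// GC.
  rewrite ge0_integralZl_EFin//.
  apply: le_trans (lee_wpmul2l _ (abs_integral_le P eta0 mTF)) _; first by rewrite lee_fin.
  apply: le_trans (lee_wpmul2l _ (leeD (lexx _) (lee_wpmul2l _ hK2))) _.
  - by rewrite lee_fin.
  - by rewrite lee_fin invr_ge0 ltW.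
  rewrite -(EFinM eta^-1) -EFinD -EFinM lee_fin expr2 mulKf ?gt_eqF//.
  have C1 : 0 < C + 1 by rewrite ltr_wpDl.
  rewrite (_ : C * (eta + eta) = (e / 2) * (C / (C + 1))); last first.
    by rewrite /eta; field; rewrite gt_eqF//; have := C1; lra.
  by rewrite ler_piMr ?(ltW e2)// ler_pdivrMr// mul1r lerDl.
apply: le_trans (leeD (leeD b1 b2) b3) _.
have addhalf (a b : \bar R) : (a + (e / 2)%:E + b + (e / 2)%:E = a + b + e%:E)%E.
  by rewrite (addeAC a) -(addeA (a + b)) -EFinD -splitr.
by rewrite addhalf.
Qed.

End stein_bound.

Theorem theorem3p1 (R : realType) (P : probability Omega R)
    (hP : is_rademacher_measure P)
    (d : measure_display) (T : measurableType d) (Q : probability T R)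
    (N : {RV Q >-> R}) (hN : is_standard_gaussian N)
    (F : Omega -> R) (hF : dom_D P F) (hF0 : ('E_P[F] = 0)%E) :
  let DF k w := D P F k w in
  let DLF k w := D P (Linv P F) k w in
  let D1 (x : R) k w := path_gradient \1_[set v : Omega | x < F v] k w in
  (kolmogorov_distance P Q F N <=
     \int[P]_w `|1 - l2_inner (DF^~ w) (fun k => (- DLF k w)%R)|
   + (Num.sqrt (2 * pi) / 4)%:E *
       \int[P]_w l2_inner (fun k => (DF k w ^+ 2)%R) (fun k => `|DLF k w|%R)
   + \int[P]_w l2_inner (fun k => (DF k w ^+ 2)%R) (fun k => `|F w * DLF k w|%R)
   + 2%:E * ereal_sup
       [set \int[P]_w l2_inner (fun k => (DF k w * D1 x k w)%R)
                               (fun k => `|DLF k w|%R) | x in [set: R]])%E.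
Proof.
pose DF k w := D P F k w; pose DLF k w := D P (Linv P F) k w.
pose D1 (y : R) k w : R := path_gradient (\1_[set v : Omega | y < F v]) k w.
cbv zeta.
have [f Ff fD] := hF.
have Fi := sq_integrable_chaos Ff.
have [Ui _] := Linv_cvg hP Ff hF0.
have [CF eF] := gradient_energy_dom_D hP hF hF0.
have [CU eU] := gradient_energy_Linv hP Ff hF0.
have divU := rad_divergence_cvg hP Ff hF0.
(* There are countably many k, so one null set serves all coordinates. *)
have aeD : {ae P, forall w, forall k, DF k w = path_gradient F k w /\
    DLF k w = path_gradient (Linv P F) k w}.
  apply: ae_foralln => k.
  have a1 := D_path_gradient hP k Ff.
  have a2 := D_path_gradient hP k (Linv_chaos_decomposition hP Ff hF0).
  by apply: filterS2 a1 a2 => w h1 h2; split.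
apply: ge_ereal_sup => _ [x _ <-].
have -> : Q [set w | N w <= x] = (normal_cdf x)%:E.
  have -> : [set w | N w <= x] = N @^-1` `]-oo, x]%classic.
    by apply/seteqP; split => w /=; rewrite in_itv.
  rewrite -[LHS]/(distribution Q N `]-oo, x]%classic) hN// /normal_cdf fineK//.
  by rewrite fin_num_measure.
apply: le_trans (stein_bound hP Fi Ui eF eU divU x) _.
(* The bound is now established for pathwise gradients; it is carried over to [D], which agrees with
   them almost surely. *)
have l2E (u v u' v' : nat -> Omega -> R) :
   {ae P, forall w, forall k, u k w = u' k w /\ v k w = v' k w} ->
   {ae P, forall w, l2_inner (u ^~ w) (v ^~ w) = l2_inner (u' ^~ w) (v' ^~ w)}.
  apply: filterS => w h; congr l2_inner; apply/funext => k; by have [] := h k.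
apply: leeD; [apply: leeD; [apply: leeD|]|].
- rewrite le_eqVlt; apply/orP; left; apply/eqP; apply: ae_eq_integralT.
  apply: filterS (l2E (path_gradient F) (fun k w => - path_gradient (Linv P F) k w)
     DF (fun k w => - DLF k w) _) => [w -> //|].
  by apply: filterS aeD => w h k; have [-> ->] := h k.
- apply: lee_wpmul2l; first by rewrite lee_fin divr_ge0 ?sqrtr_ge0.
  rewrite le_eqVlt; apply/orP; left; apply/eqP; apply: ae_eq_integralT.
  apply: (l2E (fun k w => path_gradient F k w ^+ 2) (fun k w => `|path_gradient (Linv P F) k w|)
     (fun k w => DF k w ^+ 2) (fun k w => `|DLF k w|)).
  by apply: filterS aeD => w h k; have [-> ->] := h k.
- rewrite le_eqVlt; apply/orP; left; apply/eqP; apply: ae_eq_integralT.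
  apply: (l2E (fun k w => path_gradient F k w ^+ 2)
     (fun k w => `|F w * path_gradient (Linv P F) k w|)
     (fun k w => DF k w ^+ 2) (fun k w => `|F w * DLF k w|)).
  by apply: filterS aeD => w h k; have [-> ->] := h k.
(* The term at the given x is bounded by the supremum, which must come after the integral has been
   rewritten with [D]. *)
- apply: lee_wpmul2l => //.
  rewrite (ae_eq_integralT (g := fun w => l2_inner (fun k => DF k w * D1 x k w)
     (fun k => `|DLF k w|))).
    by apply: ereal_sup_ubound; exists x.
  apply: (l2E (fun k w => path_gradient F k w * D1 x k w)
     (fun k w => `|path_gradient (Linv P F) k w|)
     (fun k w => DF k w * D1 x k w) (fun k w => `|DLF k w|)).
  by apply: filterS aeD => w h k; have [-> ->] := h k.
Qed.
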